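(* Let $r\geq 5$ be odd. The rational elements of $W(D_r)$ are precisely the elements of $$\mathcal F_r=\{w_0\}\cup\{c_I,d_I:\varnothing\neq I\subseteq\{1,\ldots,r-1\}\}.$$ Hence $\#\mathcal F_r=1+2(2^{r-1}-1)=2^r-1$. Moreover the rationality graph $\Gamma(D_r)$ is determined by the following adjacency rules, where $I$ ranges over all subsets of $\{1,\ldots,r-1\}$ and by convention $c_\varnothing=d_\varnothing=w_0$. For $1\leq a\leq r-2$, $$c_I\sim c_{I\triangle\{a\}}\iff a+1\in I,\qquad d_I\sim d_{I\triangle\{a\}}\iff a+1\in I,$$ and $$c_I\sim c_{I\triangle\{r-1\}},\qquad d_I\sim d_{I\triangle\{r-1\}}.$$ There are no other edges. In particular, $c_{\{1\}}$ and $d_{\{1\}}$ are the only vertices of valency one in $\Gamma(D_r)$.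
   Context: Root system and group. Let $e_1,\ldots,e_r$ be the standard orthonormal basis of $\mathbb R^r$. $W(D_r)$ is the group of linear maps $u$ with $u(e_j)=\varepsilon_j e_{\pi(j)}$, $\pi\in S_r$, $\varepsilon_j\in\{\pm1\}$, with an even number of negative signs $\varepsilon_j$. Positive roots: $\Pi_+=\{e_i-e_j,\ e_i+e_j:1\leq i<j\leq r\}$; $\Pi_-=-\Pi_+$. Simple roots: $\alpha_i=e_i-e_{i+1}$ ($1\leq i\leq r-1$), $\alpha_r=e_{r-1}+e_r$; $s_a$ is the reflection in $\alpha_a$. Root order: $\rho\leq\eta$ iff $\eta-\rho\in\sum_{a=1}^r\mathbb Z_{\geq0}\alpha_a$. For odd $r$ the longest element $w_0$ is given by $w_0(e_i)=-e_i$ ($1\leq i\leq r-1$), $w_0(e_r)=e_r$. Rationality. For $S\subseteq\Pi_+$ let $\operatorname{Adj}(S)=\{\gamma\in\Pi_+:\gamma\leq\beta\text{ for some }\beta\in S\}$. For $u\in W(D_r)$ let $\nu_0(u)=u(\Pi_+)\cap\Pi_+$ and $\nu_k(u)=u(\operatorname{Adj}(\nu_{k-1}(u)))\cap\Pi_+$ for $k\geq1$. The element $u$ is rational if $\nu_k(u)=\varnothing$ for all sufficiently large $k$. Rationality graph. $\Gamma(D_r)$ is the (undirected) graph whose vertices are the rational elements of $W(D_r)$, with $u\sim v$ iff $v=s_au$ for some $a\in\{1,\ldots,r\}$. Signed cyclic elements. For $\varnothing\neq I=\{i_1<\cdots<i_k\}\subseteq\{1,\ldots,r-1\}$ let $p_I\in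 S_r$ be given by $p_I(i_a)=i_{a+1}$ ($1\leq a<k$), $p_I(i_k)=r$, $p_I(r)=i_1$, and $p_I(j)=j$ for $j\notin I\cup\{r\}$. Define $c_I,d_I\in W(D_r)$ by $c_I(e_j)=-e_{p_I(j)}$ ($1\leq j\leq r-1$), $c_I(e_r)=e_{i_1}$; and $d_I(e_j)=-e_{p_I(j)}$ ($j\in\{1,\ldots,r-1\}\setminus\{i_k\}$), $d_I(e_{i_k})=e_r$, $d_I(e_r)=-e_{i_1}$. $\triangle$ denotes symmetric difference. *)

(* Defs.v *)
(* Throughout, the rank is r = n.+1 and indices are shifted down by one:
   'I_n.+1 stands for {1, ..., r}, ord_max for r, and 'I_n for {1, ..., r-1}.
   Vectors of R^r are columns, and a linear map is its matrix, acting on the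
   left, so that u *m v is u(v) and u *m v is also the composite of u and v. *)
From mathcomp Require Import all_boot all_fingroup all_algebra.
From mathcomp Require Import boolp classical_sets functions cardinality reals.

Set Implicit Arguments.
Unset Strict Implicit.
Unset Printing Implicit Defensive.

Import GRing.Theory.
Local Open Scope ring_scope.
Local Open Scope classical_set_scope.
Local Open Scope card_scope.

Section RootSystem.
Variables (R : realType) (n : nat).

Definition ebase (j : 'I_n.+1) : 'cV[R]_n.+1 := delta_mx j 0.

Definition in_WD (u : 'M[R]_n.+1) : Prop :=
  exists (p : {perm 'I_n.+1}) (neg : {set 'I_n.+1}),
    ~~ odd #|neg| /\
    forall j, u *m ebase j = (-1) ^+ (j \in neg) *: ebase (p j).

Definition pos_roots : set 'cV[R]_n.+1 :=
  [set v | exists i j : 'I_n.+1, (i < j)%N /\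
     (v = ebase i - ebase j \/ v = ebase i + ebase j)].

Definition simple_root (a : 'I_n.+1) : 'cV[R]_n.+1 :=
  if (a < n)%N then ebase a - ebase (inord a.+1)
  else ebase (inord n.-1) + ebase ord_max.

(* v |-> v - 2 <v, alpha> / <alpha, alpha> alpha *)
Definition reflection (alpha : 'cV[R]_n.+1) : 'M[R]_n.+1 :=
  1%:M - (2 / (alpha^T *m alpha) 0 0) *: (alpha *m alpha^T).

Definition root_le (rho eta : 'cV[R]_n.+1) : Prop :=
  exists m : 'I_n.+1 -> nat, eta - rho = \sum_a simple_root a *+ m a.

Definition Adj (S : set 'cV[R]_n.+1) : set 'cV[R]_n.+1 :=
  [set g | pos_roots g /\ exists2 b, S b & root_le g b].

Fixpoint nu (u : 'M[R]_n.+1) (k : nat) : set 'cV[R]_n.+1 :=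
  if k is k'.+1 then (mulmx u @` Adj (nu u k')) `&` pos_roots
  else (mulmx u @` pos_roots) `&` pos_roots.

Definition rational_elt (u : 'M[R]_n.+1) : Prop :=
  in_WD u /\ exists N : nat, forall k, (N <= k)%N -> nu u k = set0.

Definition adjacent (u v : 'M[R]_n.+1) : Prop :=
  [/\ rational_elt u, rational_elt v &
      exists a, v = reflection (simple_root a) *m u].

Definition has_valency (u : 'M[R]_n.+1) (k : nat) : Prop :=
  [set v | adjacent u v] #= `I_k.

Definition linmap (f : 'I_n.+1 -> 'cV[R]_n.+1) : 'M[R]_n.+1 :=
  \matrix_(i, j) f j i 0.

(* The longest element, for odd r. *)
Definition w0 : 'M[R]_n.+1 :=
  linmap (fun j => if j == ord_max then ebase j else - ebase j).

(* i_1, ..., i_k; the enumeration of a set of ordinals is increasing. *)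
Definition elts (I : {set 'I_n}) : seq 'I_n.+1 :=
  [seq widen_ord (leqnSn n) i | i <- enum I].

Definition first_elt (I : {set 'I_n}) : 'I_n.+1 := head ord_max (elts I).
Definition last_elt (I : {set 'I_n}) : 'I_n.+1 := last ord_max (elts I).

(* The cycle i_1 -> ... -> i_k -> r -> i_1: path.next sends an element of the
   list to its cyclic successor and fixes all other points. *)
Definition p_cycle (I : {set 'I_n}) : 'I_n.+1 -> 'I_n.+1 :=
  path.next (rcons (elts I) ord_max).

Definition c_elt (I : {set 'I_n}) : 'M[R]_n.+1 :=
  if I == finset.set0 then w0 else
  linmap (fun j => if j == ord_max then ebase (first_elt I)
                   else - ebase (p_cycle I j)).

Definition d_elt (I : {set 'I_n}) : 'M[R]_n.+1 :=
  if I == finset.set0 then w0 else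
  linmap (fun j => if j == last_elt I then ebase ord_max
                   else if j == ord_max then - ebase (first_elt I)
                   else - ebase (p_cycle I j)).

Definition rational_family : set 'M[R]_n.+1 :=
  [set u | u = w0 \/
     exists2 I : {set 'I_n}, I != finset.set0 & (u = c_elt I \/ u = d_elt I)].

End RootSystem.

Definition symdiff (T : finType) (A B : {set T}) : {set T} :=
  ((A :\: B) :|: (B :\: A))%SET.

Arguments c_elt R {n} I.
Arguments d_elt R {n} I.

(* Main.v *)
Require Import Defs.
From HB Require Import structures.
From mathcomp Require Import all_boot all_order all_fingroup all_algebra.
From mathcomp Require Import boolp classical_sets functions cardinality reals.
From mathcomp Require Import zify ring lra.

(** A root [v] lies in [nu u k] exactly when it ends a chain of positive roots
    [g_0, ..., g_k] with every [u g_i] positive, [g_(i+1) <= u g_i] and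
    [v = u g_k]; so [u] is rational iff these chains have bounded length.

    The rational elements are found by climbing to [w0].  Let [u] be rational
    and different from [w0].  Then some root of [nu u 0] exists, and the end of
    a longest chain is a positive root below which [u] makes every positive
    root negative; its support contains a simple root [alpha_a] with
    [u^-1 alpha_a] positive and [u alpha_a] negative ([rational_ascent]).  For
    such an [a] every chain of [s_a u] is dominated by a chain of [u] of the
    same length, obtained by subtracting [alpha_a] from some of its members
    ([nu_refl]), so [s_a u] is again rational.  It is longer than [u], hence
    finitely many such steps lead to [w0] ([rational_ind]).

    It remains to go down from [w0] through rational elements, that is to
    decide when [s_a c_I] is rational.  Write [I+] for [I] with [r] adjoined,
    so that [p_I] sends each member of [I+] to the next one.  If [a + 1] is in
    [I+], then [s_a] merely inserts [a] into the cycle or removes it from the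
    cycle, so that [s_a c_I = c_(I xor a)] ([refl_c_elt]), and the chains of
    [c_I] are short because the first index of their roots keeps increasing
    ([c_elt_rational]).  If [a + 1] is not in [I+], or if [a = r] and [I] is
    not empty, there is a root (once, a pair of roots) that starts an infinite
    chain ([refl_c_elt_irrational], [refl_max_c_elt_irrational]).  Finally
    [s_r w0 = d_{r-1}] ([refl_max_w0]), and conjugation by the diagram
    automorphism exchanges [c_I] and [d_I] ([d_elt_flip]), so that everything
    proved for the [c_I] holds for the [d_I].  These facts give the list of
    rational elements and all the edges of the graph at once. *)

Set Implicit Arguments.
Unset Strict Implicit.
Unset Printing Implicit Defensive.

Section Roots.
Import Order.TTheory GRing.Theory Num.Theory.
Local Open Scope ring_scope.

Variables (R : realType) (n : nat).
Local Notation vec := 'cV[R]_n.+1.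
Local Notation e := (@ebase R n).
Local Notation alpha := (@simple_root R n).
Local Notation pos := (@pos_roots R n).

(** * Scalar products and matrices given by columns *)

Definition dot (v w : vec) : R := (v^T *m w) 0 0.

Lemma dotE v w : dot v w = \sum_k v k 0 * w k 0.
Proof. by rewrite /dot mxE; apply: eq_bigr => k _; rewrite mxE. Qed.

Lemma dotC v w : dot v w = dot w v.
Proof. by rewrite !dotE; apply: eq_bigr => k _; rewrite mulrC. Qed.

Lemma dot_is_linear v : linear_for *%R (dot v).
Proof. by move=> a x y; rewrite /dot mulmxDr -scalemxAr !mxE. Qed.
HB.instance Definition _ v :=
  GRing.isLinear.Build R vec R *%R (dot v) (dot_is_linear v).

Lemma dotDr v x y : dot v (x + y) = dot v x + dot v y.
Proof. exact: linearD. Qed.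

Lemma dotBr v x y : dot v (x - y) = dot v x - dot v y.
Proof. exact: linearB. Qed.

Lemma dotNr v x : dot v (- x) = - dot v x.
Proof. exact: linearN. Qed.

Lemma dotZr v a x : dot v (a *: x) = a * dot v x.
Proof. exact: linearZ. Qed.

Lemma ebaseE j k : e j k 0 = (k == j)%:R.
Proof. by rewrite /ebase mxE andbT. Qed.

Lemma dot_ebase v j : dot v (e j) = v j 0.
Proof.
rewrite dotE (bigD1 j) //= ebaseE eqxx mulr1 big1 ?addr0 // => k kj.
by rewrite ebaseE (negPf kj) mulr0.
Qed.

Lemma dotMl u v w : dot (u *m v) w = dot v (u^T *m w).
Proof. by rewrite /dot trmx_mul mulmxA. Qed.

Lemma linmapE f j : linmap f *m e j = f j.
Proof.
by apply/matrixP => i k; rewrite -colE !mxE !ord1.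
Qed.

Lemma eq_on_ebase (u v : 'M[R]_n.+1) : (forall j, u *m e j = v *m e j) -> u = v.
Proof.
move=> uv; apply/matrixP => i j; have /matrixP/(_ i 0) := uv j.
by rewrite -!colE !mxE.
Qed.

Lemma signE (v : vec) :
  ((-1) ^+ true *: v = - v) * ((-1) ^+ false *: v = v).
Proof. by rewrite expr1 expr0 scaleN1r scale1r. Qed.

(** * Roots and their heights *)

Definition root (v : vec) : Prop :=
  exists i j (s t : bool), i != j /\ v = (-1) ^+ s *: e i + (-1) ^+ t *: e j.

(** Half the sum of the positive roots.  Pairing with it gives the height of a
    root, so that a root is positive iff its height is. *)
Definition rho : vec := \col_k (n - k)%:R.
Definition ht (v : vec) : R := dot rho v.
HB.instance Definition _ :=
  GRing.isLinear.Build R vec R *%R ht (dot_is_linear rho).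

Lemma ht_ebase j : ht (e j) = (n - j)%:R.
Proof. by rewrite /ht dot_ebase mxE. Qed.

Lemma pos_sub (i j : 'I_n.+1) : (i < j)%N -> pos (e i - e j).
Proof. by move=> ij; exists i, j; split=> //; left. Qed.

Lemma pos_add (i j : 'I_n.+1) : (i < j)%N -> pos (e i + e j).
Proof. by move=> ij; exists i, j; split=> //; right. Qed.

Lemma pos_add_ne (i j : 'I_n.+1) : i != j -> pos (e i + e j).
Proof.
rewrite neq_ltn => /orP[] ?; first exact: pos_add.
by rewrite addrC; apply: pos_add.
Qed.

Lemma pos_root v : pos v -> root v.
Proof.
case=> i [j [ij]]; have ne : i != j by rewrite neq_ltn ij.
by case=> ->; [exists i, j, false, true | exists i, j, false, false];
  rewrite ?signE.
Qed.

Lemma root_posVneg v : root v -> pos v \/ pos (- v).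
Proof.
case=> i [j [s [t [ij ->]]]].
wlog lt_ij : i j s t ij / (i < j)%N.
  move=> H; move: (ij); rewrite neq_ltn => /orP[lt|lt]; first exact: H.
  by rewrite addrC; apply: H; rewrite // eq_sym.
case: s t => [] []; rewrite ?signE.
- by right; rewrite opprD !opprK; apply: pos_add.
- by right; rewrite opprD !opprK; apply: pos_sub.
- by left; apply: pos_sub.
- by left; apply: pos_add.
Qed.

Lemma ht_pos v : pos v -> 0 < ht v.
Proof.
case=> i [j [ij]]; have := ltn_ord j => jn.
by case=> ->; rewrite ?linearB ?linearD /= !ht_ebase ?subr_gt0 -?natrD ?ltr_nat ?ltr0n; lia.
Qed.

Lemma root_ht_gt0 v : root v -> 0 < ht v -> pos v.
Proof.
by move=> /root_posVneg[//|/ht_pos]; rewrite linearN /= => ? ?; exfalso; lra.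
Qed.

Lemma root_notpos v : root v -> ~ pos v -> pos (- v).
Proof. by move=> /root_posVneg[]. Qed.

(** The possible angles in a simply laced root system; the proof evaluates the
    pairing according to which indices coincide. *)
Lemma root_dot_cases v w : root v -> root w ->
  v = w \/ [\/ v = - w, dot v w = 0, dot v w = 1 | dot v w = -1].
Proof.
case=> i [j [s [t [ij ->]]]] [k [l [s' [t' [kl ->]]]]].
have -> : dot ((-1) ^+ s *: e i + (-1) ^+ t *: e j)
              ((-1) ^+ s' *: e k + (-1) ^+ t' *: e l) =
  (-1) ^+ s * (-1) ^+ s' * (k == i)%:R + (-1) ^+ s * (-1) ^+ t' * (l == i)%:R
  + ((-1) ^+ t * (-1) ^+ s' * (k == j)%:R + (-1) ^+ t * (-1) ^+ t' * (l == j)%:R).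
  rewrite linearD !linearZ /= !dot_ebase !mxE /= !andbT; ring.
case: (k =P i) kl => [->|_] kl.
  rewrite (negPf ij) eq_sym (negPf kl); case: (l =P j) => [->|_].
    case: s s' t t' => [] [] [] []; rewrite ?signE;
    solve [by left | by right; apply: Or41; rewrite opprD ?opprK ?opprK
          | by right; apply: Or42 => /=; ring].
  case: s s' t t' => [] [] [] [] /=;
  solve [by right; apply: Or43; ring | by right; apply: Or44; ring].
case: (k =P j) kl => [->|_] kl.
  rewrite [l == j]eq_sym (negPf kl); case: (l =P i) => [->|_].
    case: s s' t t' => [] [] [] []; rewrite ?signE;
    solve [by left; rewrite addrC
          | by right; apply: Or41; rewrite opprD ?opprK ?opprK addrC
          | by right; apply: Or42 => /=; ring].
  case: s s' t t' => [] [] [] [] /=;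
  solve [by right; apply: Or43; ring | by right; apply: Or44; ring].
case: (l =P i) => [->|_]; first rewrite (negPf ij).
  case: s s' t t' => [] [] [] [] /=;
  solve [by right; apply: Or43; ring | by right; apply: Or44; ring].
case: (l =P j) => _ /=;
  case: s s' t t' => [] [] [] [] /=;
  solve [by right; apply: Or43; ring | by right; apply: Or44; ring | by right; apply: Or42; ring].
Qed.

Lemma root_normsq v : root v -> dot v v = 2.
Proof.
case=> i [j [s [t [ij ->]]]].
rewrite linearD !linearZ /= !dot_ebase !mxE /= !andbT !eqxx.
rewrite [j == i]eq_sym (negPf ij).
by case: s t => [] [] /=; ring.
Qed.

(** * Simple roots *)

Hypothesis n_gt0 : (0 < n)%N.

(** With indices starting at 0, the last simple root is indexed by [ord_max]
    and involves the last two coordinates. *)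
Lemma simple_rootP (a : 'I_n.+1) :
  (exists b : 'I_n.+1, b = a.+1 :> nat /\ alpha a = e a - e b) \/
  (a = ord_max /\ exists b : 'I_n.+1, b.+1 = n /\ alpha a = e b + e ord_max).
Proof.
rewrite /simple_root; case: ltnP => an; [left | right].
  by exists (inord a.+1); rewrite inordK.
split; first by apply/val_inj => /=; have := ltn_ord a; lia.
by exists (inord n.-1); rewrite inordK ?prednK //; lia.
Qed.

Lemma simple_root_lt (a b : 'I_n.+1) : b = a.+1 :> nat -> alpha a = e a - e b.
Proof.
move=> ba; have := ltn_ord b; rewrite ba ltnS => an.
by rewrite /simple_root an; congr (_ - e _); apply/val_inj; rewrite /= inordK.
Qed.

Lemma simple_root_max (b : 'I_n.+1) : b.+1 = n -> alpha ord_max = e b + e ord_max.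
Proof.
move=> bn; rewrite /simple_root ltnn; congr (e _ + _).
by apply/val_inj; rewrite /= inordK; lia.
Qed.

Lemma simple_pos a : pos (alpha a).
Proof.
case: (simple_rootP a) => [[b [ba ->]] | [_ [b [bn ->]]]].
  by apply: pos_sub; lia.
by apply: pos_add; rewrite /=; lia.
Qed.

Lemma ht_simple a : ht (alpha a) = 1.
Proof.
case: (simple_rootP a) => [[b [ba ->]] | [_ [b [bn ->]]]].
  rewrite linearB /= !ht_ebase ba -natrB; last by lia.
  by rewrite (_ : n - a - (n - a.+1) = 1)%N //; have := ltn_ord b; lia.
by rewrite linearD /= !ht_ebase -natrD /= (_ : n - b + (n - n) = 1)%N //; lia.
Qed.

Lemma simple_inj : injective alpha.
Proof.
move=> a b.
case: (simple_rootP a) (simple_rootP b)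
    => [[a' [aE ->]] | [aE [a' [a'n ->]]]] [[b' [bE ->]] | [bE [b' [b'n ->]]]] E.
- apply/eqP/negPn/negP => ab; move: E => /matrixP/(_ a 0).
  have aa' : (a == a') = false by apply/eqP => /(congr1 val) /=; lia.
  by rewrite !mxE /= !andbT eqxx (negPf ab) aa'; case: eqP => _ /=; lra.
- move: E => /matrixP/(_ a' 0); rewrite !mxE /= !andbT eqxx.
  have -> : (a' == a) = false by apply/eqP => /(congr1 val) /=; lia.
  by (do 2 case: eqP => _ /=); move=> H; exfalso; clear - H; lra.
- move: E => /matrixP/(_ b' 0); rewrite !mxE /= !andbT eqxx.
  have -> : (b' == b) = false by apply/eqP => /(congr1 val) /=; lia.
  by (do 2 case: eqP => _ /=); move=> H; exfalso; clear - H; lra.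
- by subst.
Qed.

(** * Signed permutations *)

Definition signed_perm (u : 'M[R]_n.+1) (p : {perm 'I_n.+1}) (s : 'I_n.+1 -> bool) :=
  forall j, u *m e j = (-1) ^+ s j *: e (p j).

(** Measuring the parity of the sign changes by a product of signs makes it
    visibly multiplicative. *)
Lemma in_WDP (u : 'M[R]_n.+1) : in_WD u <->
  exists p s, signed_perm u p s /\ \prod_j (-1) ^+ s j = 1 :> R.
Proof.
split=> [[p [N [Nev uE]]]|[p [s [uE sE]]]].
  exists p, (fun j => j \in N); split=> //.
  rewrite (eq_bigr (fun j => if j \in N then -1 else 1)); last by move=> j _; case: (j \in N).
  by rewrite -big_mkcond /= prodr_const -signr_odd (negPf Nev).
exists p, [set j | s j]%SET; split; last by move=> j; rewrite inE.
move: sE; rewrite (eq_bigr (fun j => if s j then -1 else 1)); last by move=> j _; case: (s j).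
rewrite -big_mkcond /= prodr_const -signr_odd.
rewrite (@eq_card _ (fun j => s j) (mem [set j | s j]%SET)); last by move=> j; rewrite !inE.
by case: odd => //= H; exfalso; move: H; rewrite expr1; lra.
Qed.

Lemma signed_perm_root u p s v : signed_perm u p s -> root v -> root (u *m v).
Proof.
move=> uE [i [j [t [t' [ij ->]]]]].
exists (p i), (p j), (t (+) s i), (t' (+) s j); split; first by rewrite (inj_eq perm_inj).
by rewrite mulmxDr -!scalemxAr !uE !scalerA !signr_addb.
Qed.

Lemma signed_perm_orth u p s : signed_perm u p s -> u^T *m u = 1%:M.
Proof.
move=> uE; apply/matrixP => i j.
have -> : (u^T *m u) i j = dot (u *m e i) (u *m e j).
  by rewrite dotMl mulmxA dotC dot_ebase -colE !mxE.
rewrite !uE linearZ /= dot_ebase !mxE andbT (inj_eq perm_inj) [j == i]eq_sym.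
by case: eqP => [->|_]; rewrite ?mulr0 //= mulr1 -signr_addb addbb.
Qed.

Lemma signed_perm_tr u p s : signed_perm u p s ->
  signed_perm u^T p^-1 (fun j => s (p^-1 j)%g).
Proof.
move=> uE j; have /(congr1 (fun M => M *m e (p^-1 j)%g)) := signed_perm_orth uE.
rewrite mul1mx -mulmxA uE permKV -scalemxAr => /(congr1 (fun v => (-1) ^+ s (p^-1 j)%g *: v)).
by rewrite scalerA -signr_addb addbb scale1r.
Qed.

Lemma signed_permM u v p q s t : signed_perm u p s -> signed_perm v q t ->
  signed_perm (u *m v) (q * p)%g (fun j => t j (+) s (q j)).
Proof.
by move=> uE vE j; rewrite -mulmxA vE -scalemxAr uE scalerA -signr_addb permM.
Qed.

Lemma in_WDM (u v : 'M[R]_n.+1) : in_WD u -> in_WD v -> in_WD (u *m v).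
Proof.
move=> /in_WDP[p [s [uE sE]]] /in_WDP[q [t [vE tE]]]; apply/in_WDP.
exists (q * p)%g, (fun j => t j (+) s (q j)); split; first exact: signed_permM.
under eq_bigr do rewrite signr_addb.
rewrite big_split /= tE mul1r -[RHS]sE [RHS](reindex_inj (@perm_inj _ q)).
by [].
Qed.

Lemma WD_root (u : 'M[R]_n.+1) v : in_WD u -> root v -> root (u *m v).
Proof. by move=> [p [N [_ uE]]]; apply: (@signed_perm_root u p (fun j => j \in N)). Qed.

Lemma WD_tr_root (u : 'M[R]_n.+1) v : in_WD u -> root v -> root (u^T *m v).
Proof.
by move=> /in_WDP[p [s [/signed_perm_tr uE _]]]; apply: signed_perm_root uE.
Qed.

Lemma WD_orth (u : 'M[R]_n.+1) : in_WD u -> u^T *m u = 1%:M.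
Proof. by move=> /in_WDP[p [s [/signed_perm_orth]]]. Qed.

Lemma reflE a v :
  reflection (alpha a) *m v = v - dot (alpha a) v *: alpha a.
Proof.
rewrite /reflection -/(dot _ _) root_normsq; last exact/pos_root/simple_pos.
rewrite divff ?pnatr_eq0 // scale1r mulmxBl mul1mx -mulmxA; congr (_ - _).
by rewrite [_^T *m v]mx11_scalar mul_mx_scalar.
Qed.

Lemma refl_ebase (a b j : 'I_n.+1) : b = a.+1 :> nat ->
  reflection (alpha a) *m e j = e (tperm a b j).
Proof.
move=> ba; have ab : a != b by rewrite -val_eqE /= ba; lia.
rewrite reflE dot_ebase (simple_root_lt ba) !mxE /= !andbT.
case: tpermP => [->|->|/eqP/negPf ja /eqP/negPf jb].
- by rewrite eqxx (negPf ab) subr0 scale1r opprB addrCA subrr addr0.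
- by rewrite eqxx eq_sym (negPf ab) sub0r scaleN1r opprK addrCA subrr addr0.
- by rewrite ja jb subrr scale0r subr0.
Qed.

Lemma refl_max_ebase (b j : 'I_n.+1) : b.+1 = n ->
  reflection (alpha ord_max) *m e j =
  if j == ord_max then - e b else if j == b then - e ord_max else e j.
Proof.
move=> bn; have bm : (b == ord_max) = false by apply/eqP => /(congr1 val) /=; lia.
rewrite reflE dot_ebase (simple_root_max bn) !mxE /= !andbT.
have [->|jm] := eqVneq j ord_max.
  by rewrite eq_sym bm add0r scale1r opprD addrC addrNK.
have [->|jb] := eqVneq j b; last by rewrite addr0 scale0r subr0.
by rewrite addr0 scale1r opprD addrA subrr sub0r.
Qed.

Lemma refl_signed_perm a : exists p s,
  signed_perm (reflection (alpha a)) p s /\ \prod_j (-1) ^+ s j = 1 :> R.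
Proof.
case: (simple_rootP a) => [[b [ba _]] | [-> [b [bn _]]]].
  exists (tperm a b), (fun=> false); split; last by rewrite big1.
  by move=> j; rewrite (refl_ebase _ ba) signE.
have bm : b != ord_max by rewrite -val_eqE /=; lia.
exists (tperm b ord_max), (fun j => (j == b) || (j == ord_max)); split; last first.
  rewrite (bigD1 b) //= (bigD1 ord_max) ?eqxx //= ?orbT; last by rewrite eq_sym.
  rewrite big1 => [|j /andP[/negPf-> /negPf->]] //.
  by rewrite mulr1 expr1 mulrNN mulr1.
move=> j; rewrite (refl_max_ebase _ bn).
case: tpermP => [->|->|/eqP/negPf jb /eqP/negPf jm].
- by rewrite eqxx (negPf bm) signE.
- by rewrite eqxx orbT signE.
- by rewrite jb jm signE.
Qed.

Lemma refl_WD a : in_WD (reflection (alpha a)).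
Proof. exact/in_WDP/refl_signed_perm. Qed.

Lemma reflK a (v : vec) : reflection (alpha a) *m (reflection (alpha a) *m v) = v.
Proof.
rewrite !reflE dotBr dotZr.
rewrite root_normsq; last exact/pos_root/simple_pos.
rewrite -addrA -opprD -scalerDl; set x := dot _ _.
by have -> : x + (x - x * 2) = 0; [ring | rewrite scale0r subr0].
Qed.

Lemma root_sub_simple a v : root v -> dot (alpha a) v = 1 -> root (v - alpha a).
Proof.
move=> rv av; have := WD_root (refl_WD a) rv.
by rewrite reflE av scale1r.
Qed.

(** A pairing equal to 1 would make [alpha b - alpha a], the reflection of
    [alpha b], a root of height 0. *)
Lemma dot_simple_le0 a b : a != b -> dot (alpha a) (alpha b) <= 0.
Proof.
move=> ab; have ra := pos_root (simple_pos a); have rb := pos_root (simple_pos b).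
have [E|[E|->|E|->]] := root_dot_cases ra rb; rewrite ?lerN10 //.
- by move: ab; rewrite (simple_inj E) eqxx.
- by have := congr1 ht E; rewrite linearN /= !ht_simple => H; exfalso; clear - H; lra.
- have /root_posVneg[] := root_sub_simple rb E => /ht_pos;
  by rewrite ?linearN linearB /= !ht_simple => H; exfalso; clear - H; lra.
Qed.

(** * The root order *)

(** The vectors that are nonnegative for the root order: [root_le v w] is by
    definition [cone (w - v)]. *)
Definition cone (v : vec) : Prop := exists m : 'I_n.+1 -> nat, v = \sum_a alpha a *+ m a.

Lemma cone0 : cone 0.
Proof. by exists (fun=> 0%N); rewrite big1. Qed.

Lemma coneD v w : cone v -> cone w -> cone (v + w).
Proof.
move=> [m ->] [m' ->]; exists (fun a => m a + m' a)%N; rewrite -big_split /=.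
by apply: eq_bigr => a _; rewrite mulrnDr.
Qed.

Lemma cone_simple a : cone (alpha a).
Proof.
exists (fun b => b == a : nat); rewrite (bigD1 a) //= eqxx big1 ?addr0 // => b /negPf->.
by [].
Qed.

Lemma cone_sub (i j : 'I_n.+1) : (i <= j)%N -> cone (e i - e j).
Proof.
case: j => j jn /= ij.
elim: j jn ij => [|j IH] jn ij.
  have -> : i = Ordinal jn by apply/val_inj => /=; lia.
  by rewrite subrr; apply: cone0.
move: ij; rewrite leq_eqVlt => /orP[/eqP E|ij].
  have -> : i = Ordinal jn by apply/val_inj.
  by rewrite subrr; apply: cone0.
rewrite -[_ - _](subrKA (e (Ordinal (ltnW jn)))).
apply: coneD; first exact: IH.
by rewrite -simple_root_lt //; apply: cone_simple.
Qed.

Lemma cone_add (i j : 'I_n.+1) : (i < j)%N -> cone (e i + e j).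
Proof.
move=> ij; have n1n : (n.-1 < n.+1)%N by lia.
have -> : e i + e j = (e i - e (Ordinal n1n)) + (e j - e ord_max) + alpha ord_max.
  rewrite (@simple_root_max (Ordinal n1n)) /= ?prednK // [X in _ = X + _]addrACA -opprD.
  by rewrite subrK.
apply: coneD; last exact: cone_simple.
by have ? := ltn_ord j; apply: coneD; apply: cone_sub => /=; lia.
Qed.

Lemma cone_pos v : pos v -> cone v.
Proof.
by move=> [i [j [ij [] ->]]]; [apply: cone_sub; apply: ltnW | apply: cone_add].
Qed.

(** Dominant vectors give the necessary conditions for the root order. *)
Lemma cone_ge0 (phi : vec) v : (forall a, 0 <= dot phi (alpha a)) -> cone v -> 0 <= dot phi v.
Proof.
move=> phi0 [m ->]; rewrite linear_sum /=; apply: sumr_ge0 => a _.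
by rewrite linearMn /= mulrn_wge0.
Qed.

Lemma cone_ht_nat v : cone v -> exists k : nat, ht v = k%:R.
Proof.
case=> m ->; exists (\sum_a m a)%N; rewrite linear_sum /= natr_sum.
by apply: eq_bigr => a _; rewrite linearMn /= ht_simple.
Qed.

Lemma pos_ht_ge1 v : pos v -> 1 <= ht v.
Proof.
move=> vp; have := ht_pos vp; have [k ->] := cone_ht_nat (cone_pos vp).
by rewrite ltr0n ler1n.
Qed.

Lemma cone_sub_simple (m : 'I_n.+1 -> nat) a :
  (0 < m a)%N -> cone (\sum_b alpha b *+ m b - alpha a).
Proof.
move=> ma; exists (fun b => m b - (b == a))%N.
rewrite (bigD1 a) //= [in RHS](bigD1 a) //= eqxx addrAC; congr (_ + _).
  by rewrite -{1}(subnK ma) mulrnDr mulr1n addrK.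
by apply: eq_bigr => b /negPf->; rewrite subn0.
Qed.

(** Heights of roots are nonzero integers, and a simple reflection changes the
    height of a root by at most 1 unless that root is proportional to its own. *)
Lemma pos_refl a v : pos v -> v <> alpha a -> pos (reflection (alpha a) *m v).
Proof.
move=> vp va; rewrite reflE.
have rr := WD_root (refl_WD a) (pos_root vp); rewrite reflE in rr.
have vh := pos_ht_ge1 vp.
have [E|[E|->|E|E]] := root_dot_cases (pos_root (simple_pos a)) (pos_root vp).
- by rewrite E in va.
- by have := ht_simple a; rewrite E linearN /= => H; exfalso; clear - H vh; lra.
- by rewrite scale0r subr0.
- rewrite E scale1r in rr *; case: (root_posVneg rr) => // /ht_pos.
  rewrite linearN linearB /= ht_simple => H; exfalso; clear - H vh; lra.
- rewrite E scaleN1r opprK in rr *; apply: root_ht_gt0 => //.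
  by rewrite linearD /= ht_simple; clear - vh; lra.
Qed.

(** * Chains of an element and of its ascents *)

Lemma nu_mem (u : 'M[R]_n.+1) k v : nu u k v -> pos v /\ exists2 g, pos g & u *m g = v.
Proof.
by case: k => [|k] [[g gP <-] vp]; split=> //; exists g => //; case: gP.
Qed.

Lemma nuS (u : 'M[R]_n.+1) k g b : nu u k b -> pos g -> cone (b - g) -> pos (u *m g) ->
  nu u k.+1 (u *m g).
Proof. by move=> ub gp bg ugp; split=> //; exists g => //; split=> //; exists b. Qed.

Lemma nu0I (u : 'M[R]_n.+1) g : pos g -> pos (u *m g) -> nu u 0 (u *m g).
Proof. by move=> gp ugp; split=> //; exists g. Qed.

Lemma WD_trK (u : 'M[R]_n.+1) (v : vec) : in_WD u -> u^T *m (u *m v) = v.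
Proof. by move=> /WD_orth uu; rewrite mulmxA uu mul1mx. Qed.

(** A chain [g_i] for [s_a u] yields the chain for [u] in which [g_(i+1)] is kept
    if it lies below [b = u g_i], and is replaced by [g_(i+1) - alpha_a]
    otherwise.  In the second case [s_a b = b + alpha_a] and [g_(i+1)] contains
    [alpha_a] as often as [s_a b] does; then the remaining difference pairs
    nonpositively with [alpha_a], which forces the pairing of [g_(i+1)] with
    [alpha_a] to be 1 and makes [g_(i+1) - alpha_a] a root.  As [u alpha_a] is
    negative, the modified roots have larger images, and the chain goes on. *)
Lemma nu_refl (u : 'M[R]_n.+1) a : in_WD u ->
  pos (u^T *m alpha a) -> pos (- (u *m alpha a)) ->
  forall k d, nu (reflection (alpha a) *m u) k d ->
  exists2 d', nu u k d' & cone (d' - reflection (alpha a) *m d).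
Proof.
move=> uW asc desc.
(* The only root that could change sign under s_a comes from the negative
   root - u^-1 alpha_a. *)
have ascg g : pos g -> pos (reflection (alpha a) *m (u *m g)) -> pos (u *m g).
  move=> gp sugp; rewrite -(reflK a (u *m g)); apply: pos_refl => // E.
  have gE : g = - (u^T *m alpha a).
    rewrite -(WD_trK g uW) -(reflK a (u *m g)) E reflE root_normsq; last exact/pos_root/simple_pos.
    by rewrite -mulmxN; congr (_ *m _); rewrite scaler_nat mulr2n opprD addrA subrr sub0r.
  have := ht_pos gp; have := ht_pos asc; rewrite gE linearN /= => H1 H2.
  by exfalso; clear - H1 H2; lra.
elim=> [|k IH] d.
  case=> [[g gp]]; rewrite -mulmxA => dE dp; subst d.
  exists (u *m g); first by apply: nu0I => //; apply: ascg.
  by rewrite reflK subrr; apply: cone0.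
case=> [[g [gp [d' vd' d'g]]]]; rewrite -mulmxA => dE dp; subst d.
have ugp := ascg _ gp dp; rewrite reflK.
have [e' ue' ce'] := IH _ vd'.
have [d'p [g' g'p]] := nu_mem vd'; rewrite -mulmxA => d'E.
have bp : pos (reflection (alpha a) *m d').
  by rewrite -d'E reflK; apply: ascg; rewrite ?d'E.
set b := reflection (alpha a) *m d' in bp ce'.
have d'b : d' = b - dot (alpha a) b *: alpha a by rewrite -reflE reflK.
have done_if : cone (b - g) ->
    exists2 d'' : vec, nu u k.+1 d'' & cone (d'' - u *m g).
  move=> bg; exists (u *m g); last by rewrite subrr; apply: cone0.
  by apply: (nuS ue') => //; rewrite -(subrKA b); apply: coneD.
have ar := pos_root (simple_pos a).
have [E|[E|E|E|E]] := root_dot_cases ar (pos_root bp).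
- have := ht_pos d'p; rewrite d'b -E root_normsq // linearB linearZ /= ht_simple.
  by move=> H; exfalso; clear - H; lra.
- have := ht_pos bp; have := ht_simple a; rewrite E linearN /= => H1 H2.
  by exfalso; clear - H1 H2; lra.
- by apply: done_if; rewrite E scale0r subr0 in d'b; rewrite -d'b.
- apply: done_if; rewrite E scale1r in d'b.
  have -> : b - g = (d' - g) + alpha a by rewrite d'b addrAC subrK.
  by apply: coneD => //; apply: cone_simple.
(* Here d' = b + alpha a, and the multiplicity m a tells whether g <= b. *)
rewrite E scaleN1r opprK in d'b.
have [m mE] := d'g; have [ma|ma] := posnP (m a); last first.
  apply: done_if; have -> : b - g = (d' - g) - alpha a.
    by rewrite d'b addrAC addrK.
  by rewrite [d' - g]mE; apply: cone_sub_simple.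
have le0 : dot (alpha a) (d' - g) <= 0.
  rewrite [d' - g]mE linear_sum /=; apply: sumr_le0 => c _; rewrite linearMn /=.
  have [->|ca] := eqVneq c a; first by rewrite ma mulr0n.
  by rewrite mulrn_wle0 // dot_simple_le0 // eq_sym.
have ag : dot (alpha a) g = 1.
  move: le0; rewrite dotBr {1}d'b dotDr E root_normsq //.
  have [F|[->|->|->|->]] := root_dot_cases ar (pos_root gp) => H //; try by clear - H; lra.
    move: ugp desc; rewrite F => /ht_pos H1 /ht_pos; rewrite linearN /= => H2.
    by exfalso; clear - H1 H2; lra.
  by move: H; rewrite dotC dotNr root_normsq; [clear - R n; lra | exact: pos_root].
have gap : pos (g - alpha a).
  rewrite -[alpha a]scale1r -{1}ag -reflE; apply: pos_refl => // F.
  by move: ag; rewrite F root_normsq // => H; clear - H; lra.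
have ugap : pos (u *m (g - alpha a)).
  apply: root_ht_gt0; first by apply: WD_root => //; apply: pos_root.
  by rewrite mulmxBr linearB /=; move: (ht_pos ugp) (ht_pos desc); rewrite linearN /=;
    clear; lra.
exists (u *m (g - alpha a)).
  apply: (nuS ue') => //.
  have -> : e' - (g - alpha a) = (e' - b) + (d' - g).
    by rewrite d'b opprB -!addrA; congr (_ + _); rewrite addKr addrC.
  exact: coneD.
by rewrite mulmxBr addrAC subrr sub0r; apply: cone_pos.
Qed.

Lemma rational_refl (u : 'M[R]_n.+1) a : rational_elt u ->
  pos (u^T *m alpha a) -> pos (- (u *m alpha a)) ->
  rational_elt (reflection (alpha a) *m u).
Proof.
move=> [uW [N uN]] asc desc; split; first exact: in_WDM (refl_WD a) uW.
exists N => k /uN uk; rewrite -subset0 => d /(nu_refl uW asc desc)[d' + _].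
by rewrite uk.
Qed.

(** The root [b] that ends a longest chain is a sum of simple roots, all of which
    [u] makes negative, since otherwise the chain could be prolonged; as [u^-1 b]
    is positive, [u^-1] makes at least one of them positive. *)
Lemma rational_ascent (u : 'M[R]_n.+1) : rational_elt u -> nu u 0 <> set0 ->
  exists a, pos (u^T *m alpha a) /\ pos (- (u *m alpha a)).
Proof.
move=> [uW [N uN]] u0.
have ex : exists k, `[< nu u k = set0 >] by exists N; apply/asboolP/uN.
case: (ex_minnP ex) => -[/asboolP E|k /asboolP uk mink]; first by case: u0.
have /set0P[b ub] : nu u k != set0.
  by apply/eqP => /asboolP/mink; rewrite ltnn.
have [bp [g gp gb]] := nu_mem ub; have [m bE] := cone_pos bp.
have [a ma aht] : exists2 a, (0 < m a)%N & 0 < ht (u^T *m alpha a).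
  apply: contrapT => no; have := ht_pos gp; rewrite -(WD_trK g uW) gb bE.
  rewrite mulmx_sumr linear_sum /= ltNge => /negP; apply; apply: sumr_le0 => a _.
  rewrite raddfMn /= linearMn /=.
  have [->|ma] := posnP (m a); first by rewrite mulr0n.
  rewrite mulrn_wle0 // leNgt; apply/negP => aht; apply: no; by exists a.
have ar := pos_root (simple_pos a); exists a; split.
  by apply: root_ht_gt0 => //; apply: WD_tr_root.
apply: root_notpos; first exact: WD_root.
move=> uap; have : nu u k.+1 (u *m alpha a); last by rewrite uk.
apply: (nuS ub) => //; first exact: simple_pos.
by rewrite bE; apply: cone_sub_simple.
Qed.

(** An increasing permutation dominates the identity, and so does its inverse. *)
Lemma perm_increasing (p : {perm 'I_n.+1}) :
  (forall i j : 'I_n.+1, (i < j)%N -> (p i < p j)%N) -> p = 1%g.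
Proof.
have ge (q : {perm 'I_n.+1}) :
    (forall i j : 'I_n.+1, (i < j)%N -> (q i < q j)%N) -> forall j : 'I_n.+1, (j <= q j)%N.
  move=> qi [j jn]; elim: j jn => // j IH jn /=.
  by apply: leq_ltn_trans (IH (ltnW jn)) _; apply: qi => /=.
move=> pi; apply/permP => j; rewrite perm1; apply/val_inj/eqP => /=.
rewrite eqn_leq ge // andbT.
rewrite -{2}(permK p j); apply: ge => x y xy; rewrite ltnNge leq_eqVlt.
apply/negP => /orP[/eqP/val_inj/perm_inj E|/pi]; first by rewrite E ltnn in xy.
by rewrite !permKV ltnNge ltnW.
Qed.

Lemma w0E j : w0 R n *m e j = (-1) ^+ (j != ord_max) *: e j.
Proof. by rewrite linmapE; case: eqP => _; rewrite signE. Qed.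

(** If [u] makes all [e i - e j] and [e i + e j] with [i < j] negative, then it
    changes the sign of every [e i] but the last one and preserves the order of
    the indices; the parity of the sign changes then fixes the last sign. *)
Lemma nu0_eq0_w0 (u : 'M[R]_n.+1) : ~~ odd n -> in_WD u -> nu u 0 = set0 -> u = w0 R n.
Proof.
move=> nev uW u0.
have neg g : pos g -> ht (u *m g) < 0.
  move=> gp; have : ~ pos (u *m g) by move=> ugp; have := nu0I gp ugp; rewrite u0.
  by move=> /(root_notpos (WD_root uW (pos_root gp)))/ht_pos; rewrite linearN /= oppr_gt0.
have [p [s [uE sE]]] := (in_WDP u).1 uW.
have hu j : ht (u *m e j) = (-1) ^+ s j * (n - p j)%:R.
  by rewrite uE linearZ /= ht_ebase.
have main (i j : 'I_n.+1) : (i < j)%N -> s i /\ (p i < p j)%N.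
  move=> ij; have := neg _ (pos_sub ij); have := neg _ (pos_add ij).
  rewrite mulmxDr mulmxBr linearD linearB /= !hu.
  have := ltn_ord (p i); have := ltn_ord (p j); rewrite !ltnS => pj pi.
  have := ler0n R (n - p i); have := ler0n R (n - p j).
  have -> : (p i < p j)%N = ((n - p j)%:R < (n - p i)%:R :> R) by rewrite ltr_nat; lia.
  move: (n - p i)%:R (n - p j)%:R => x y; clear - R n.
  by case: (s i) (s j) => [] []; rewrite /= ?expr1 ?expr0 => *; split=> //; lra.
have p1 : p = 1%g by apply: perm_increasing => i j /main[].
have sT j : j != ord_max -> s j.
  by move=> jm; apply: (main j ord_max _).1; rewrite ltn_neqAle jm /= -ltnS.
have sF : s ord_max = false.
  move: sE; rewrite (bigD1 ord_max) //= (eq_bigr (fun=> -1)); last by move=> j /sT->.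
  rewrite prodr_const (_ : #|_| = n); last first.
    by have := cardC1 (@ord_max n); rewrite card_ord.
  rewrite -[(-1) ^+ n]signr_odd (negPf nev).
  by case: (s _) => //=; rewrite ?expr1 ?expr0 => H; exfalso; clear - H; lra.
apply: eq_on_ebase => j; rewrite uE w0E p1 perm1.
by have [->|/sT->//] := eqVneq j ord_max; rewrite sF.
Qed.

(** Passing from [u] to [s_a u] with [u^-1 alpha_a] positive decreases the pairing
    of [rho] with [u rho] by the height of [u^-1 alpha_a], which is at least 1,
    whereas this pairing is bounded below by minus the square norm of [rho]. *)
Lemma rational_ind (P : 'M[R]_n.+1 -> Prop) : ~~ odd n ->
  P (w0 R n) ->
  (forall u a, rational_elt u -> rational_elt (reflection (alpha a) *m u) ->
     P (reflection (alpha a) *m u) -> P u) ->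
  forall u, rational_elt u -> P u.
Proof.
move=> nev P0 PS.
pose Q (u : 'M[R]_n.+1) := dot rho (u *m rho) + dot rho rho.
(* 2 Q u is the square norm of u rho + rho. *)
have Q_ge0 u : in_WD u -> 0 <= Q u.
  move=> uW; have : 0 <= dot (u *m rho + rho) (u *m rho + rho).
    by rewrite dotE; apply: sumr_ge0 => k _; rewrite -expr2 sqr_ge0.
  rewrite dotDr ![dot (_ + _) _]dotC !dotDr dotMl WD_trK // [dot (_ *m _) _]dotC.
  by rewrite /Q => H; clear - H; lra.
suff main k u : rational_elt u -> Q u < k%:R -> P u.
  move=> u ur; apply: (main (Num.bound (Q u))) => //.
  by apply: archi_boundP; apply: Q_ge0; case: ur.
elim: k u => [|k IH] u ur; first by rewrite ltNge Q_ge0 //; case: ur.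
rewrite -natr1 => Qk; have uW := ur.1.
have [E|u0] := eqVneq (nu u 0) set0; first by rewrite (nu0_eq0_w0 nev uW E).
have [a [asc desc]] := rational_ascent ur (elimN eqP u0).
have sur := rational_refl ur asc desc.
apply: (PS _ a) => //; apply: IH => //.
have := pos_ht_ge1 asc; rewrite /ht -dotMl dotC => ge1.
move: Qk; rewrite /Q -mulmxA reflE dotBr dotZr -/(ht (alpha a)) ht_simple.
by move=> Qk; clear - Qk ge1; lra.
Qed.

(** The chain [g, g', g, g', ...] never stops. *)
Lemma irrational_cycle2 (u : 'M[R]_n.+1) g g' :
  pos g -> pos g' -> pos (u *m g) -> pos (u *m g') ->
  cone (u *m g - g') -> cone (u *m g' - g) -> ~ rational_elt u.
Proof.
move=> gp g'p ugp ug'p gg' g'g [_ [N uN]].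
have : nu u N (u *m g) /\ nu u N (u *m g'); last by rewrite uN // => -[].
elim: N {uN} => [|k [IH IH']]; first by split; apply: nu0I.
by split; [apply: nuS IH' _ _ _ | apply: nuS IH _ _ _].
Qed.

Lemma irrational_cycle1 (u : 'M[R]_n.+1) g :
  pos g -> pos (u *m g) -> cone (u *m g - g) -> ~ rational_elt u.
Proof. by move=> *; apply: (@irrational_cycle2 u g g). Qed.

(** * The cyclic permutations *)

(** [I] with the last index adjoined, in increasing order: the points moved by
    [p_cycle I] when [I] is not empty. *)
Definition cyc_dom (I : {set 'I_n}) : seq 'I_n.+1 := rcons (elts I) ord_max.
(** The successor of [j] in the cycle is the least element of [cyc_dom I] that is
    at least [lower j]; the value 0 at the last index makes the cycle wrap around. *)
Definition lower (j : 'I_n.+1) : nat := if j == ord_max then 0%N else j.+1.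
Local Notation wid := (widen_ord (leqnSn n)).

Lemma elts_sorted (I : {set 'I_n}) : sorted (relpre val ltn) (elts I).
Proof.
rewrite -sorted_map /elts -map_comp (eq_map (g := val)) //.
rewrite -[enum _](eq_filter (mem_enum _)).
rewrite -(eq_filter (mem_map val_inj _)) -filter_map.
by rewrite (sorted_filter ltn_trans) // unlock val_ord_enum iota_ltn_sorted.
Qed.

Lemma max_notin_elts (I : {set 'I_n}) : ord_max \notin elts I.
Proof.
by apply/mapP => -[i _ /(congr1 val) /=]; have := ltn_ord i; lia.
Qed.

Lemma wid_elts (I : {set 'I_n}) i : (wid i \in elts I) = (i \in I).
Proof.
rewrite /elts mem_map ?mem_enum // => x y /(congr1 val) /= xy.
exact: val_inj.
Qed.

Lemma wid_neq_max (i : 'I_n) : (wid i == ord_max) = false.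
Proof. by apply/eqP => /(congr1 val) /=; have := ltn_ord i; lia. Qed.

Lemma wid_dom (I : {set 'I_n}) i : (wid i \in cyc_dom I) = (i \in I).
Proof. by rewrite mem_rcons inE wid_neq_max wid_elts. Qed.

Lemma max_dom (I : {set 'I_n}) : ord_max \in cyc_dom I.
Proof. by rewrite mem_rcons mem_head. Qed.

Lemma neq_max_lt (j : 'I_n.+1) : j != ord_max -> (j < n)%N.
Proof. by move=> jm; rewrite ltn_neqAle jm /= -ltnS. Qed.

Lemma ord_wid (j : 'I_n.+1) : j = ord_max \/ exists i, j = wid i.
Proof.
have [->|jm] := eqVneq j ord_max; [by left | right].
by exists (Ordinal (neq_max_lt jm)); apply/val_inj.
Qed.

Lemma cyc_dom_sorted (I : {set 'I_n}) : sorted (relpre val ltn) (cyc_dom I).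
Proof.
have tr : transitive (relpre val ltn : rel 'I_n.+1) by move=> ? ? ?; apply: ltn_trans.
rewrite sorted_pairwise // pairwise_rcons -sorted_pairwise // elts_sorted andbT.
by apply/allP => _ /mapP[i _ ->] /=.
Qed.

Lemma cyc_dom_uniq (I : {set 'I_n}) : uniq (cyc_dom I).
Proof.
apply: (sorted_uniq (leT := relpre val ltn)) (cyc_dom_sorted I).
  by move=> ? ? ?; apply: ltn_trans.
by move=> x /=; rewrite ltnn.
Qed.

Lemma p_cycle_notin (I : {set 'I_n}) j : j \notin cyc_dom I -> p_cycle I j = j.
Proof. by rewrite /p_cycle next_nth => /negPf->. Qed.

Lemma p_cycle_inj (I : {set 'I_n}) : injective (p_cycle I).
Proof. exact: can_inj (prev_next (cyc_dom_uniq I)). Qed.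

Lemma p_cycle_in (I : {set 'I_n}) j : j \in cyc_dom I ->
  [/\ p_cycle I j \in cyc_dom I, (lower j <= p_cycle I j)%N &
      forall y : 'I_n.+1, y \in cyc_dom I -> (lower j <= y)%N -> (p_cycle I j <= y)%N].
Proof.
move=> jI; have pI : p_cycle I j \in cyc_dom I by rewrite mem_next.
have lastI : last ord_max (cyc_dom I) = ord_max by rewrite last_rcons.
have srt := cyc_dom_sorted I; have uq := cyc_dom_uniq I.
have tr : transitive (relpre val ltn : rel 'I_n.+1) by move=> ? ? ?; apply: ltn_trans.
move: pI; rewrite /p_cycle -/(cyc_dom I) next_nth jI.
case sE: (cyc_dom I) jI => [//|y s] jI; rewrite sE in srt uq lastI.
have kb : (index j (y :: s) < (size s).+1)%N by rewrite index_mem.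
have mono := sorted_ltn_nth tr y srt.
have [ks|] := ltnP (index j (y :: s)) (size s); last first.
  move=> sk; have kE : index j (y :: s) = size s by lia.
  rewrite kE nth_default // => _.
  have jE : j = ord_max.
    by rewrite -lastI -(nth_index y jI) kE (last_nth y).
  rewrite jE /lower eqxx; split=> // [|z]; first by rewrite mem_head.
  rewrite inE => /orP[/eqP->//|zs] _.
  by have /allP/(_ z zs)/ltnW := order_path_min tr srt.
move=> pI; have jlt : (j < nth y s (index j (y :: s)))%N.
  rewrite -{1}(nth_index y jI); apply: (mono _ (index j (y :: s)).+1) => //.
have jm : j != ord_max by rewrite -val_eqE /=; have := ltn_ord (nth y s (index j (y :: s))); lia.
rewrite /lower (negPf jm); split=> // z zs jz.
rewrite leqNgt; apply/negP => zlt.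
have zi : (index z (y :: s) < (size s).+1)%N by rewrite index_mem.
have [zk|kz|E] := ltngtP (index z (y :: s)) (index j (y :: s)).
- have := mono _ _ zi kb zk; rewrite !nth_index // => H.
  by have := ltn_trans jz H; rewrite ltnn.
- have [E|kz'] := eqVneq (index z (y :: s)) (index j (y :: s)).+1.
    by move: zlt; rewrite -{1}(nth_index y zs) E /= ltnn.
  have lt' : ((index j (y :: s)).+1 < index z (y :: s))%N by rewrite ltn_neqAle eq_sym kz'.
  have := mono (index j (y :: s)).+1 _ ks zi lt'; rewrite nth_index // => H.
  by have := ltn_trans zlt H; rewrite ltnn.
- by have := jz; rewrite -(nth_index y zs) E nth_index // ltnn.
Qed.

Lemma p_cycle_eq (I : {set 'I_n}) (j x : 'I_n.+1) : j \in cyc_dom I -> x \in cyc_dom I ->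
  (lower j <= x)%N ->
  (forall y : 'I_n.+1, y \in cyc_dom I -> (lower j <= y)%N -> (x <= y)%N) ->
  p_cycle I j = x.
Proof.
move=> jI xI jx xmin; have [pI jp pmin] := p_cycle_in jI.
by apply/val_inj/eqP; rewrite /= eqn_leq pmin //= xmin.
Qed.

Lemma p_cycle_max (I : {set 'I_n}) : p_cycle I ord_max = first_elt I.
Proof.
apply: p_cycle_eq; rewrite ?max_dom // /lower ?eqxx // /first_elt.
  by rewrite /cyc_dom; case: (elts I) => [|x s]; rewrite mem_head.
move=> y; rewrite /cyc_dom; have := elts_sorted I.
case: (elts I) => [|x s] /=; first by rewrite inE => _ /eqP->.
have tr : transitive (relpre val ltn : rel 'I_n.+1) by move=> ? ? ?; apply: ltn_trans.
move=> /(order_path_min tr)/allP xs; rewrite inE mem_rcons inE.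
by move=> /orP[/eqP->//|/orP[/eqP->|/xs/ltnW//]] _; rewrite -ltnS ltn_ord.
Qed.

Lemma last_elt_max (I : {set 'I_n}) : I != finset.set0 ->
  last_elt I \in elts I /\ forall y : 'I_n.+1, y \in elts I -> (y <= last_elt I)%N.
Proof.
move=> /set0Pn[i iI].
have := wid_elts I i; rewrite iI /last_elt; have := elts_sorted I.
case/lastP: (elts I) => [//|s x] + _; rewrite last_rcons.
have tr : transitive (relpre val ltn : rel 'I_n.+1) by move=> ? ? ?; apply: ltn_trans.
rewrite sorted_pairwise // pairwise_rcons.
move=> /andP[/allP sx _]; split=> [|y]; rewrite mem_rcons ?mem_head //.
by rewrite inE => /orP[/eqP->//|/sx/ltnW].
Qed.

Lemma p_cycle_last (I : {set 'I_n}) : I != finset.set0 -> p_cycle I (last_elt I) = ord_max.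
Proof.
move=> /last_elt_max[lI lmax].
have lm : last_elt I != ord_max by apply: contraNneq (max_notin_elts I) => <-.
apply: p_cycle_eq; rewrite ?max_dom ?mem_rcons ?inE ?lI ?orbT // /lower (negPf lm) ?neq_max_lt //.
move=> y; rewrite mem_rcons inE => /orP[/eqP->//|/lmax yl].
by rewrite ltnNge yl.
Qed.

(** * The elements c_I and their reflections *)

Definition p_perm (I : {set 'I_n}) : {perm 'I_n.+1} := perm (@p_cycle_inj I).

(** The convention for the empty set agrees with the general formula, since the
    cycle reduced to the last index is the identity. *)
Lemma c_eltE (I : {set 'I_n}) j :
  c_elt R I *m e j = (-1) ^+ (j != ord_max) *: e (p_cycle I j).
Proof.
rewrite /c_elt; have [->|I0] := eqVneq I finset.set0.
  rewrite w0E; congr (_ *: e _); have [->|jm] := eqVneq j ord_max.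
    by rewrite p_cycle_max /first_elt /elts enum_set0.
  by rewrite p_cycle_notin // /cyc_dom /elts enum_set0 /= inE.
rewrite linmapE; case: eqP => [->|_]; rewrite signE //.
by rewrite p_cycle_max.
Qed.

Lemma prod_sign_neq_max : ~~ odd n -> \prod_(j < n.+1) (-1) ^+ (j != ord_max) = 1 :> R.
Proof.
move=> nev; rewrite (bigD1 ord_max) //= eqxx mul1r (eq_bigr (fun=> -1)); last by move=> j ->.
rewrite prodr_const (_ : #|_| = n); last first.
  by have := cardC1 (@ord_max n); rewrite card_ord.
by rewrite -signr_odd (negPf nev).
Qed.

Lemma c_elt_WD (I : {set 'I_n}) : ~~ odd n -> in_WD (c_elt R I).
Proof.
move=> nev; apply/in_WDP; exists (p_perm I), (fun j => j != ord_max).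
by split; [move=> j; rewrite c_eltE permE | exact: prod_sign_neq_max].
Qed.

Lemma p_cycle_gt (I : {set 'I_n}) (j : 'I_n.+1) :
  j \in cyc_dom I -> j != ord_max -> (j < p_cycle I j)%N.
Proof. by move=> /p_cycle_in[_ + _] => /[swap] /negPf jm; rewrite /lower jm. Qed.

Lemma p_cycle_ge (I : {set 'I_n}) (j : 'I_n.+1) :
  j != ord_max -> (j <= p_cycle I j)%N.
Proof.
move=> jm; have [jI|/p_cycle_notin->//] := boolP (j \in cyc_dom I).
exact/ltnW/p_cycle_gt.
Qed.

Lemma ebase_inj : injective e.
Proof.
move=> x y /matrixP/(_ x 0); rewrite !ebaseE eqxx.
by case: eqP => // _ /eqP; rewrite oner_eq0.
Qed.

Lemma ebase_neqN x y : e x = - e y -> False.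
Proof.
move=> /matrixP/(_ x 0); rewrite !mxE !andbT eqxx.
by case: (x == y) => /= H; clear - H; lra.
Qed.

Lemma c_elt_inj : injective (@c_elt R n).
Proof.
move=> I J E; have pE : p_cycle I =1 p_cycle J.
  move=> j; have := c_eltE I j; rewrite E c_eltE => /(congr1 (fun v => (-1) ^+ (j != ord_max) *: v)).
  by rewrite !scalerA -signr_addb addbb !scale1r => /ebase_inj.
have mem (K : {set 'I_n}) i : (i \in K) = (p_cycle K (wid i) != wid i).
  rewrite -wid_dom; have [iK|/p_cycle_notin->] := boolP (_ \in _); last by rewrite eqxx.
  apply/esym; rewrite -val_eqE gtn_eqF //; apply: p_cycle_gt => //.
  by rewrite wid_neq_max.
by apply/setP => i; rewrite !mem pE.
Qed.

Lemma mem_symdiff (T : finType) (A B : {set T}) x :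
  (x \in symdiff A B) = (x \in A) (+) (x \in B).
Proof. by rewrite /symdiff !inE; do 2 case: (x \in _). Qed.

Lemma symdiffK (I : {set 'I_n}) a : symdiff (symdiff I [set a]%SET) [set a]%SET = I.
Proof. by apply/setP => x; rewrite !mem_symdiff addbK. Qed.

Lemma symdiff1_inj (I : {set 'I_n}) a b :
  symdiff I [set a]%SET = symdiff I [set b]%SET -> a = b.
Proof.
move=> /setP/(_ a); rewrite !mem_symdiff !inE eqxx => /addbI/esym/eqP.
by [].
Qed.

Lemma cyc_dom_symdiff (I : {set 'I_n}) (a : 'I_n) j :
  (j \in cyc_dom (symdiff I [set a]%SET)) = (j \in cyc_dom I) (+) (j == wid a).
Proof.
have [->|[i ->]] := ord_wid j; first by rewrite !max_dom eq_sym wid_neq_max.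
rewrite !wid_dom mem_symdiff inE; congr (_ (+) _).
Qed.

(** As [b] directly follows [a], the new element [a] takes the place of [b] after
    the predecessor of [b], and is itself followed by [b]. *)
Lemma p_cycle_symdiff (I : {set 'I_n}) (a : 'I_n) (b : 'I_n.+1) j :
  b = a.+1 :> nat -> b \in cyc_dom I -> a \notin I ->
  p_cycle (symdiff I [set a]%SET) j = tperm (wid a) b (p_cycle I j).
Proof.
move=> ba bI aI; have aD : wid a \notin cyc_dom I by rewrite wid_dom.
have ab : wid a != b by apply: contraNneq aD => ->.
have dom y : (y \in cyc_dom (symdiff I [set a]%SET)) = (y \in cyc_dom I) || (y == wid a).
  by rewrite cyc_dom_symdiff; case: eqP => [->|_]; rewrite ?(negPf aD) ?addbF ?orbF.
have [->|ja] := eqVneq j (wid a).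
  rewrite [p_cycle I _]p_cycle_notin // tpermL.
  apply: p_cycle_eq; rewrite ?dom ?bI ?eqxx ?orbT // /lower wid_neq_max /= ?ba //.
have [jI|jI] := boolP (j \in cyc_dom I); last first.
  have jb : j != b by apply: contraNneq jI => ->.
  rewrite !p_cycle_notin ?dom ?negb_or ?jI ?ja // tpermD 1?eq_sym //.
have [pI jp pmin] := p_cycle_in jI.
have [pb|pb] := eqVneq (p_cycle I j) b.
  rewrite pb tpermR; apply: p_cycle_eq; rewrite ?dom ?jI ?eqxx ?orbT //.
    move: jp; rewrite pb ba leq_eqVlt ltnS => /orP[/eqP|//].
    rewrite /lower; case: eqP => // _ [E].
    by case/eqP: ja; apply/val_inj.
  move=> y; rewrite dom => /orP[yI jy|/eqP->//].
  by have := pmin y yI jy; rewrite pb ba => /ltnW.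
have pa : p_cycle I j != wid a by apply: contraNneq aD => <-.
rewrite tpermD 1?eq_sym //; apply: p_cycle_eq; rewrite ?dom ?jI ?pI //.
move=> y; rewrite dom => /orP[yI jy|/eqP-> ja']; first exact: pmin.
have : (p_cycle I j <= b)%N by apply: pmin => //; rewrite ba ltnW.
by rewrite leq_eqVlt val_eqE (negPf pb) /= ba ltnS.
Qed.

(** It suffices to insert [a]; removing it is the same identity read backwards. *)
Lemma refl_c_elt (I : {set 'I_n}) (a : 'I_n) (b : 'I_n.+1) :
  b = a.+1 :> nat -> b \in cyc_dom I ->
  reflection (alpha (wid a)) *m c_elt R I = c_elt R (symdiff I [set a]%SET).
Proof.
move=> ba; have bA : b = (wid a).+1 :> nat by [].
have main J : b \in cyc_dom J -> a \notin J ->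
    reflection (alpha (wid a)) *m c_elt R J = c_elt R (symdiff J [set a]%SET).
  move=> bJ aJ; apply: eq_on_ebase => j.
  rewrite -mulmxA !c_eltE -scalemxAr (refl_ebase _ bA); congr (_ *: e _).
  by rewrite (p_cycle_symdiff _ ba bJ aJ).
move=> bI; have [aI|] := boolP (a \in I); last exact: main.
have aJ : a \notin symdiff I [set a]%SET by rewrite mem_symdiff inE eqxx aI.
have bJ : b \in cyc_dom (symdiff I [set a]%SET).
  by rewrite cyc_dom_symdiff bI /=; apply/eqP => E; move: ba; rewrite E /=; lia.
have := main _ bJ aJ; rewrite symdiffK => <-.
by apply: eq_on_ebase => j; rewrite -!mulmxA reflK.
Qed.

(** Every positive image of a positive root under [c_I] has the form
    [e x - e y], and below such a root there are only roots [e i - e j] with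
    [x <= i < j].  Moreover [c_I] sends [e i - e j] to a positive root only for
    [i] in the cycle and [j] outside it, between [i] and its successor, and the
    image [e j - e (p_I i)] starts at [j > i]. *)
Lemma c_elt_rational (I : {set 'I_n}) : ~~ odd n -> rational_elt (c_elt R I).
Proof.
move=> nev; split; first exact: c_elt_WD.
(* Partial sums of coordinates are nonnegative on simple roots. *)
have psum_cone v m : cone v -> 0 <= dot (\col_k (k <= m)%N%:R) v.
  apply: cone_ge0 => a; case: (simple_rootP a) => [[b [ba ->]] | [_ [b [bn ->]]]].
    rewrite dotBr !dot_ebase !mxE subr_ge0 ler_nat ba.
    by case: (leqP a m); case: (ltnP a m) => //; lia.
  by rewrite dotDr !dot_ebase !mxE -natrD ler0n.
have step g : pos g -> pos (c_elt R I *m g) ->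
    exists x y : 'I_n.+1, [/\ (x < y)%N, c_elt R I *m g = e x - e y &
      forall i j : 'I_n.+1, (i < j)%N -> g = e i - e j -> (i < x)%N].
  move=> [i [j [ij gE]]] cgp; have im : i != ord_max.
    by rewrite -val_eqE /=; have := ltn_ord j; lia.
  have hge0 x : 0 <= ht (e x) by rewrite ht_ebase ler0n.
  case: gE cgp => gE; rewrite gE ?mulmxBr ?mulmxDr !c_eltE im signE.
    have [->|jm] := eqVneq j ord_max; rewrite signE => cgp.
      exfalso; have := ht_pos cgp; rewrite linearB linearN /=.
      by have := hge0 (p_cycle I i); have := hge0 (p_cycle I ord_max) => H1 H2 H3;
        clear - H1 H2 H3; lra.
    have pji : (p_cycle I j < p_cycle I i)%N.
      have := ht_pos cgp; rewrite opprK linearD linearN /= !ht_ebase => H.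
      have : (n - p_cycle I i)%:R < (n - p_cycle I j)%:R :> R by clear - H; lra.
      by rewrite ltr_nat; lia.
    have iI : i \in cyc_dom I.
      apply: contraT => /p_cycle_notin pi; move: pji; rewrite pi.
      by have := p_cycle_ge I jm; lia.
    have pj : p_cycle I j = j.
      apply: p_cycle_notin; apply/negP => jI.
      have [_ _ pmin] := p_cycle_in iI.
      have : (p_cycle I i <= j)%N by apply: pmin => //; rewrite /lower (negPf im).
      by have := p_cycle_ge I jm; lia.
    exists j, (p_cycle I i); rewrite opprK addrC pj; split=> // [|i' j' i'j' E].
      by rewrite -{1}pj.
    have := ij; suff -> : i' = i by [].
    apply/eqP; move: E => /matrixP/(_ i' 0); rewrite !mxE !andbT eqxx.
    have -> : (i' == j') = false by apply/eqP => E; rewrite E ltnn in i'j'.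
    by case: (i' == i) => //; case: (i' == j) => /= H; clear - H; lra.
  have [->|jm] := eqVneq j ord_max; rewrite signE => cgp; last first.
    exfalso; have := ht_pos cgp; rewrite linearD linearN /= linearN /=.
    by have := hge0 (p_cycle I i); have := hge0 (p_cycle I j) => H1 H2 H3;
      clear - H1 H2 H3; lra.
  exists (p_cycle I ord_max), (p_cycle I i); rewrite addrC; split=> // [|i' j' i'j' E].
    have := ht_pos cgp; rewrite linearD linearN /= !ht_ebase => H.
    have : (n - p_cycle I i)%:R < (n - p_cycle I ord_max)%:R :> R by clear - H; lra.
    by rewrite ltr_nat; lia.
  exfalso; move/(congr1 (dot (const_mx 1))): E; rewrite dotDr dotBr !dot_ebase !mxE.
  by move=> H; clear - H; lra.
have main k v : nu (c_elt R I) k v ->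
    exists x y : 'I_n.+1, [/\ (x < y)%N, v = e x - e y & (k <= x)%N].
  elim: k v => [|k IH] v.
    move=> [[g gp <-] cgp]; have [x [y [xy vE _]]] := step g gp cgp.
    by exists x, y.
  move=> [[g [gp [d /IH[x [y [xy -> kx]]] dg]] <-] cgp].
  have [x' [y' [xy' vE H]]] := step g gp cgp.
  exists x', y'; split=> //; apply: leq_ltn_trans kx _.
  case: gp dg => i [j [ij [] gE]] dg.
    apply: leq_ltn_trans (H i j ij gE).
    have := psum_cone _ i dg; rewrite gE !dotBr !dot_ebase !mxE.
    by rewrite leqnn [(j <= i)%N]leqNgt ij /=; case: (leqP x i) => //; case: (leqP y i) => _ _ /=; lra.
  have := psum_cone _ n dg; rewrite gE !dotBr dotDr !dot_ebase !mxE.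
  by rewrite !leq_ord /= => H'; exfalso; clear - H'; lra.
exists n.+1 => k nk; rewrite -subset0 => v /main[x [_ [_ _ kx]]].
by have := ltn_ord x; rewrite ltnNge => /negP; apply; apply: leq_trans nk kx.
Qed.

Lemma p_cycle_max_neq (I : {set 'I_n}) : I != finset.set0 -> p_cycle I ord_max != ord_max.
Proof.
move=> /set0Pn[i iI].
have [_ _ /(_ (wid i))] := p_cycle_in (max_dom I).
rewrite wid_dom iI /lower eqxx => /(_ isT isT) fi.
by rewrite -val_eqE /= ltn_eqF //; apply: leq_ltn_trans fi _ => /=.
Qed.

(** Since [p_I] fixes [a + 1], the simple root [alpha_a] is mapped to a root
    [e a - e x] with [x > a], which lies above it. *)
Lemma refl_c_elt_irrational (I : {set 'I_n}) (a : 'I_n) (b : 'I_n.+1) :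
  b = a.+1 :> nat -> b \notin cyc_dom I ->
  ~ rational_elt (reflection (alpha (wid a)) *m c_elt R I).
Proof.
move=> ba bI; have bA : b = (wid a).+1 :> nat by [].
have bm : b != ord_max by apply: contraNneq bI => ->; apply: max_dom.
have ab : wid a != b by rewrite -val_eqE /= ba; lia.
have cE j : j != ord_max -> reflection (alpha (wid a)) *m c_elt R I *m e j =
    - e (tperm (wid a) b (p_cycle I j)).
  by move=> jm; rewrite -mulmxA c_eltE jm signE mulmxN (refl_ebase _ bA).
set x := tperm (wid a) b (p_cycle I (wid a)).
have bx : (b <= x)%N.
  rewrite /x; have [aI|/p_cycle_notin->] := boolP (wid a \in cyc_dom I); last by rewrite tpermL.
  have pa : (a < p_cycle I (wid a))%N by apply: p_cycle_gt; rewrite ?wid_neq_max.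
  rewrite tpermD ?ba //; first by rewrite -val_eqE /= neq_ltn pa.
  by apply: contraNneq bI => ->; case: (p_cycle_in aI).
have uE : reflection (alpha (wid a)) *m c_elt R I *m (e (wid a) - e b) = e (wid a) - e x.
  by rewrite mulmxBr !cE ?wid_neq_max // (p_cycle_notin bI) tpermR opprK addrC.
apply: (@irrational_cycle1 _ (e (wid a) - e b)).
- by apply: pos_sub; rewrite ba /=.
- by rewrite uE; apply: pos_sub; rewrite /= -ba.
- by rewrite uE opprB addrC addrA subrK; apply: cone_sub.
Qed.

(** The root [alpha_r = e k + e r] is mapped to a root above it, except when [I]
    consists of [k = r - 1] alone: then [alpha_(r-1)] and [alpha_r] are exchanged. *)
Lemma refl_max_c_elt_irrational (I : {set 'I_n}) : I != finset.set0 ->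
  ~ rational_elt (reflection (alpha ord_max) *m c_elt R I).
Proof.
move=> I0; have kn : (n.-1 < n)%N by lia.
pose K := Ordinal kn; pose k := wid K.
have kE : k.+1 = n by rewrite /= prednK.
have km : k != ord_max by rewrite wid_neq_max.
have km' : (k < @ord_max n)%N by rewrite /= prednK.
set u := reflection _ *m _.
set f := p_cycle I ord_max.
have fm : f != ord_max by apply: p_cycle_max_neq.
have fk : (f <= k)%N by have := neq_max_lt fm => /= ?; lia.
have um : u *m e ord_max = if f == k then - e ord_max else e f.
  by rewrite -mulmxA c_eltE eqxx signE (refl_max_ebase _ kE) (negPf fm).
have uk : u *m e k = if K \in I then e k else e ord_max.
  rewrite -mulmxA c_eltE km signE mulmxN (refl_max_ebase _ kE).
  case: (boolP (K \in I)) => KI; last first.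
    by rewrite (p_cycle_notin (j := k)) ?wid_dom // (negPf km) eqxx opprK.
  rewrite (_ : p_cycle I k = ord_max) ?eqxx ?opprK //.
  apply/val_inj/eqP; rewrite /= eqn_leq -ltnS ltn_ord /=.
  have : (k < p_cycle I k)%N by apply: p_cycle_gt; rewrite ?wid_dom.
  by rewrite kE.
move: um uk; have [fkE|fk'] := eqVneq f k => um; case: ifPn => KI uk.
- apply: (@irrational_cycle2 _ (e k + e ord_max) (e k - e ord_max)).
  + exact: pos_add.
  + exact: pos_sub.
  + by rewrite mulmxDr um uk; apply: pos_sub.
  + by rewrite mulmxBr um uk opprK; apply: pos_add.
  + by rewrite mulmxDr um uk subrr; apply: cone0.
  + by rewrite mulmxBr um uk opprK subrr; apply: cone0.
- by move: KI; rewrite -wid_dom -/k -fkE; case: (p_cycle_in (max_dom I)) => ->.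
- apply: (@irrational_cycle1 _ (e k + e ord_max)); first exact: pos_add.
    by rewrite mulmxDr um uk; apply: pos_add_ne; rewrite eq_sym.
  by rewrite mulmxDr um uk opprD addrACA subrr add0r; apply: cone_sub; apply: leq_ord.
- apply: (@irrational_cycle1 _ (e k + e ord_max)); first exact: pos_add.
    by rewrite mulmxDr um uk; apply: pos_add_ne; rewrite eq_sym.
  by rewrite mulmxDr um uk [e ord_max + _]addrC opprD addrACA subrr addr0; apply: cone_sub.
Qed.

(** * The diagram automorphism *)

(** The reflection in the last coordinate, which permutes the simple roots by
    exchanging the last two. *)
Definition flip : 'M[R]_n.+1 := linmap (fun j => (-1) ^+ (j == ord_max) *: e j).

Lemma flip_ebase j : flip *m e j = (-1) ^+ (j == ord_max) *: e j.
Proof. exact: linmapE. Qed.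

Lemma flipK m : cancel (mulmx flip : 'M[R]_(n.+1, m) -> _) (mulmx flip).
Proof.
move=> v; rewrite mulmxA (_ : flip *m flip = 1%:M) ?mul1mx //.
apply: eq_on_ebase => j.
by rewrite -mulmxA flip_ebase -scalemxAr flip_ebase scalerA -signr_addb addbb scale1r mul1mx.
Qed.

Lemma flipKr m (u : 'M[R]_(m, n.+1)) : u *m flip *m flip = u.
Proof.
have -> : u *m flip *m flip = u *m (flip *m (flip *m 1%:M)) by rewrite mulmx1 mulmxA.
by rewrite flipK mulmx1.
Qed.

Lemma flip_pos v : pos v -> pos (flip *m v).
Proof.
case=> i [j [ij]]; have im : (i == ord_max) = false.
  by rewrite -val_eqE /= ltn_eqF //; apply: leq_trans ij (leq_ord j).
case=> ->; exists i, j; split=> //; rewrite ?mulmxBr ?mulmxDr !flip_ebase im.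
  by case: eqP => _; rewrite !signE ?opprK; [right | left].
by case: eqP => _; rewrite !signE; [left | right].
Qed.

Lemma cone_flip v : cone v -> cone (flip *m v).
Proof.
case=> m ->; rewrite mulmx_sumr; apply: (big_ind cone); [exact: cone0 | exact: coneD |].
move=> a _; rewrite raddfMn /=; elim: (m a) => [|k IH]; first exact: cone0.
rewrite mulrS; apply: coneD => //.
exact/cone_pos/flip_pos/simple_pos.
Qed.

Lemma nu_flip (u : 'M[R]_n.+1) k v : nu (flip *m u *m flip) k v -> nu u k (flip *m v).
Proof.
elim: k v => [|k IH] v.
  case=> [[g gp <-]] gp'; rewrite -!mulmxA flipK.
  apply: nu0I; first exact: flip_pos.
  by have := flip_pos gp'; rewrite -!mulmxA flipK.
case=> [[g [gp [d /IH ud dg]] <-]] gp'; rewrite -!mulmxA flipK.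
apply: nuS ud _ _ _; first exact: flip_pos.
  by rewrite -mulmxBr; apply: cone_flip.
by have := flip_pos gp'; rewrite -!mulmxA flipK.
Qed.

Lemma rational_flip (u : 'M[R]_n.+1) : rational_elt u -> rational_elt (flip *m u *m flip).
Proof.
move=> [uW [N uN]]; split; last first.
  exists N => k /uN uk; rewrite -subset0 => v /nu_flip.
  by rewrite uk.
move: uW => /in_WDP[p [s [uE sE]]]; apply/in_WDP.
exists p, (fun j => (j == ord_max) (+) (s j (+) (p j == ord_max))); split=> [j|].
  rewrite -!mulmxA flip_ebase -!scalemxAr uE -scalemxAr flip_ebase.
  by rewrite !scalerA !signr_addb mulrA.
under eq_bigr do rewrite !signr_addb.
rewrite !big_split /= sE mul1r.
rewrite [X in X * _](reindex_inj (@perm_inj _ p)) -big_split big1 //= => j _.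
by rewrite -signr_addb addbb.
Qed.

Lemma dot_flip v w : dot (flip *m v) w = dot v (flip *m w).
Proof.
rewrite dotMl; congr (dot _ (_ *m _)); apply/matrixP => i j; rewrite !mxE !andbT.
by have [->|_] := eqVneq i j; rewrite ?mulr0.
Qed.

Lemma flip_simple a : exists a', flip *m alpha a = alpha a'.
Proof.
have [[b [ba aE]] | [aE [b [bn bE]]]] := simple_rootP a.
  have am : a != ord_max by rewrite -val_eqE /=; have := ltn_ord b; lia.
  rewrite aE mulmxBr !flip_ebase (negPf am) signE.
  have [bm|_] := eqVneq b ord_max; rewrite signE; last by exists a.
  exists ord_max; rewrite opprK bm; apply/esym/simple_root_max.
  by rewrite -ba bm.
exists b; rewrite bE mulmxDr !flip_ebase eqxx signE -val_eqE /=.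
rewrite ltn_eqF; last by lia.
by rewrite signE; apply/esym/simple_root_lt.
Qed.

Lemma flip_refl a : exists a',
  reflection (alpha a) *m flip = flip *m reflection (alpha a').
Proof.
have [a' aE] := flip_simple a; exists a'; apply: eq_on_ebase => j.
apply: (can_inj (@flipK _)); rewrite -!mulmxA flipK !reflE mulmxBr flipK -scalemxAr.
by rewrite -dot_flip aE.
Qed.

Lemma adjacent_flip (u v : 'M[R]_n.+1) :
  adjacent u v -> adjacent (flip *m u *m flip) (flip *m v *m flip).
Proof.
move=> [ru rv [a vE]]; have [a' fE] := flip_refl a.
split; try exact: rational_flip; exists a'.
rewrite vE -[in LHS](flipK u) !mulmxA; do 2 congr (_ *m _).
by rewrite -[flip *m _ *m _]mulmxA fE flipK.
Qed.

Lemma d_elt_flip (I : {set 'I_n}) : d_elt R I = flip *m c_elt R I *m flip.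
Proof.
apply: eq_on_ebase => j.
rewrite -!mulmxA flip_ebase -!scalemxAr c_eltE -scalemxAr flip_ebase !scalerA.
rewrite /d_elt; have [->|I0] := eqVneq I finset.set0.
  rewrite w0E [p_cycle _ _](_ : _ = j).
    by rewrite -!signr_addb; case: (j == ord_max).
  have [->|jm] := eqVneq j ord_max; first by rewrite p_cycle_max /first_elt /elts enum_set0.
  by rewrite p_cycle_notin // /cyc_dom /elts enum_set0 /= inE.
rewrite linmapE -!signr_addb addbN addbb.
have lm := p_cycle_last I0.
have pm : (p_cycle I j == ord_max) = (j == last_elt I).
  by rewrite -[X in _ == X]lm (inj_eq (@p_cycle_inj I)).
rewrite pm; case: ifP => [/eqP->|_]; first by rewrite signE lm.
by rewrite signE; case: eqP => [->|//]; rewrite p_cycle_max.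
Qed.

(** * The rational elements and their graph *)

Hypothesis n_even : ~~ odd n.

Lemma d_elt_rational (I : {set 'I_n}) : rational_elt (d_elt R I).
Proof. by rewrite d_elt_flip; apply/rational_flip/c_elt_rational. Qed.

Lemma flip_flip (u : 'M[R]_n.+1) : flip *m (flip *m u *m flip) *m flip = u.
Proof. by rewrite -!mulmxA flipK mulmxA flipKr. Qed.

Lemma c_elt_flip (I : {set 'I_n}) : c_elt R I = flip *m d_elt R I *m flip.
Proof. by rewrite d_elt_flip flip_flip. Qed.

Lemma symdiff0 (I : {set 'I_n}) : symdiff finset.set0 I = I.
Proof. by apply/setP => x; rewrite mem_symdiff inE. Qed.

Lemma c_elt0 : c_elt R finset.set0 = w0 R n.
Proof. by rewrite /c_elt eqxx. Qed.

Lemma d_elt0 : d_elt R finset.set0 = w0 R n.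
Proof. by rewrite /d_elt eqxx. Qed.

Lemma refl_max_w0 (K : 'I_n) : K.+1 = n ->
  reflection (alpha ord_max) *m w0 R n = d_elt R [set K]%SET.
Proof.
move=> Kn; have sflip : reflection (alpha ord_max) *m flip = flip *m reflection (alpha (wid K)).
  apply: eq_on_ebase => j.
  rewrite -!mulmxA flip_ebase -scalemxAr (@refl_max_ebase (wid K)) //.
  rewrite (@refl_ebase _ ord_max) // flip_ebase.
  case: tpermP => [->|->|/eqP jk /eqP jm].
  - by rewrite wid_neq_max !eqxx !signE.
  - by rewrite wid_neq_max eqxx !signE opprK.
  - by rewrite (negPf jk) (negPf jm) !signE.
rewrite d_elt_flip -(symdiff0 [set K]%SET) -(@refl_c_elt _ _ ord_max) ?max_dom //.
rewrite [flip *m _]mulmxA -sflip -!mulmxA; congr (_ *m _).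
by rewrite mulmxA -d_elt_flip d_elt0.
Qed.

Lemma adjacent_c_elt (I : {set 'I_n}) (a : 'I_n) (b : 'I_n.+1) :
  b = a.+1 :> nat -> b \in cyc_dom I ->
  adjacent (c_elt R I) (c_elt R (symdiff I [set a]%SET)).
Proof.
move=> ba bI; split; try exact: c_elt_rational.
by exists (wid a); rewrite (refl_c_elt ba bI).
Qed.

Lemma adjacent_d_elt (I : {set 'I_n}) (a : 'I_n) (b : 'I_n.+1) :
  b = a.+1 :> nat -> b \in cyc_dom I ->
  adjacent (d_elt R I) (d_elt R (symdiff I [set a]%SET)).
Proof. by move=> ba bI; rewrite !d_elt_flip; apply/adjacent_flip/(adjacent_c_elt ba bI). Qed.

Lemma refl_c_elt_cases (I : {set 'I_n}) x :
  rational_elt (reflection (alpha x) *m c_elt R I) ->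
  (exists (a : 'I_n) (b : 'I_n.+1), [/\ b = a.+1 :> nat, b \in cyc_dom I &
     reflection (alpha x) *m c_elt R I = c_elt R (symdiff I [set a]%SET)]) \/
  (I = finset.set0 /\ exists K : 'I_n,
     K.+1 = n /\ reflection (alpha x) *m c_elt R I = d_elt R (symdiff I [set K]%SET)).
Proof.
have [->|[a ->]] := ord_wid x => rat; [right | left].
  have [E|I0] := eqVneq I finset.set0; last by case: (refl_max_c_elt_irrational I0 rat).
  split=> //; have kn : (n.-1 < n)%N by lia.
  exists (Ordinal kn); have Kn : (Ordinal kn).+1 = n by rewrite /= prednK.
  by split=> //; rewrite E symdiff0 c_elt0; apply: refl_max_w0.
have bn : (a.+1 < n.+1)%N by rewrite ltnS.
exists a, (Ordinal bn).
have [bI|bI] := boolP (Ordinal bn \in cyc_dom I).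
  by split=> //; apply: (refl_c_elt _ bI).
by case: (refl_c_elt_irrational _ bI rat).
Qed.

Lemma adjacent_c_cases (I : {set 'I_n}) v : adjacent (c_elt R I) v ->
  (exists (a : 'I_n) (b : 'I_n.+1), [/\ b = a.+1 :> nat, b \in cyc_dom I &
     v = c_elt R (symdiff I [set a]%SET)]) \/
  (I = finset.set0 /\ exists K : 'I_n,
     K.+1 = n /\ v = d_elt R (symdiff I [set K]%SET)).
Proof. by move=> [_ rv [x E]]; rewrite E in rv *; apply: refl_c_elt_cases. Qed.

Lemma adjacent_d_cases (I : {set 'I_n}) v : adjacent (d_elt R I) v ->
  (exists (a : 'I_n) (b : 'I_n.+1), [/\ b = a.+1 :> nat, b \in cyc_dom I &
     v = d_elt R (symdiff I [set a]%SET)]) \/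
  (I = finset.set0 /\ exists K : 'I_n,
     K.+1 = n /\ v = c_elt R (symdiff I [set K]%SET)).
Proof.
move=> /adjacent_flip; rewrite -c_elt_flip => /adjacent_c_cases.
case=> [[a [b [ba bI E]]]|[I0 [K [Kn E]]]]; [left|right].
  by exists a, b; split=> //; rewrite d_elt_flip -E flip_flip.
by split=> //; exists K; split=> //; rewrite c_elt_flip -E flip_flip.
Qed.

Lemma rational_familyP (u : 'M[R]_n.+1) :
  rational_family u <-> exists I, u = c_elt R I \/ u = d_elt R I.
Proof.
split=> [[->|[I _ cd]]|[I cd]]; last first.
- have [I0|I0] := eqVneq I finset.set0; last by right; exists I.
  by left; move: cd; rewrite I0 c_elt0 d_elt0 => -[].
- by exists I.
- by exists finset.set0; left; rewrite c_elt0.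
Qed.

Lemma rational_eltP (u : 'M[R]_n.+1) :
  rational_elt u <-> exists I, u = c_elt R I \/ u = d_elt R I.
Proof.
split=> [|[I [->|->]]]; [|exact: c_elt_rational|exact: d_elt_rational].
move: u; apply: rational_ind => // [|u a ru sru [I sE]].
  by exists finset.set0; left; rewrite c_elt0.
have adj : adjacent (reflection (alpha a) *m u) u.
  by split=> //; exists a; apply: eq_on_ebase => j; rewrite -!mulmxA reflK.
by case: sE adj => -> => [/adjacent_c_cases|/adjacent_d_cases]
    [[b [? [_ _ ->]]]|[_ [K [_ ->]]]]; eexists; eauto.
Qed.

Lemma c_elt_eq_d_elt (I J : {set 'I_n}) :
  c_elt R I = d_elt R J -> I = finset.set0 /\ J = finset.set0.
Proof.
have [->|J0] := eqVneq J finset.set0.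
  by rewrite d_elt0 -c_elt0 => /c_elt_inj.
move=> /(congr1 (fun M => M *m e ord_max)); rewrite d_elt_flip -!mulmxA flip_ebase eqxx signE.
rewrite !mulmxN !c_eltE eqxx !signE flip_ebase (negPf (p_cycle_max_neq J0)) signE.
by move=> /ebase_neqN.
Qed.

Lemma d_elt_inj : injective (@d_elt R n).
Proof.
by move=> I J E; apply: c_elt_inj; rewrite !c_elt_flip E.
Qed.

Lemma adjacent_c_eltP (I : {set 'I_n}) (a : 'I_n) (b : 'I_n.+1) : b = a.+1 :> nat ->
  adjacent (c_elt R I) (c_elt R (symdiff I [set a]%SET)) <-> b \in cyc_dom I.
Proof.
move=> ba; split; last exact: adjacent_c_elt.
case/adjacent_c_cases=> [[a' [b' [b'a b'I /c_elt_inj/symdiff1_inj aa]]]|[I0 [K [_ /c_elt_eq_d_elt[E _]]]]].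
  by rewrite (_ : b = b') //; apply/val_inj => /=; rewrite ba b'a aa.
by move: E; rewrite I0 symdiff0 => /setP/(_ a); rewrite !inE eqxx.
Qed.

Lemma adjacent_d_eltP (I : {set 'I_n}) (a : 'I_n) (b : 'I_n.+1) : b = a.+1 :> nat ->
  adjacent (d_elt R I) (d_elt R (symdiff I [set a]%SET)) <-> b \in cyc_dom I.
Proof.
move=> ba; split; last exact: adjacent_d_elt.
by move=> /adjacent_flip; rewrite -!c_elt_flip => /adjacent_c_eltP; apply.
Qed.

(** The family is the image of the pairs [(I, b)], where [b] tells [d_I] from
    [c_I] and one of the two pairs with [I] empty is left out. *)
Lemma rational_family_card :
  card_eq (@rational_family R n) (`I_(1 + 2 * (2 ^ n - 1)))%classic.
Proof.
pose A : {set {set 'I_n} * bool} := [set~ (finset.set0, true)]%SET.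
pose f (x : {set 'I_n} * bool) := if x.2 then d_elt R x.1 else c_elt R x.1.
pose g (i : 'I_#|A|) := f (enum_val i).
have f_inj : {in A &, injective f}.
  move=> [I []] [J []]; rewrite !inE /f /= => IA JA.
  - by move=> /d_elt_inj->.
  - by move=> /esym/c_elt_eq_d_elt[_ I0]; rewrite I0 eqxx in IA.
  - by move=> /c_elt_eq_d_elt[_ J0]; rewrite J0 eqxx in JA.
  - by move=> /c_elt_inj->.
have -> : rational_family (n:=n) = (g @` setT)%classic.
  apply/seteqP; split=> [u|_ [i _ <-]]; last first.
    by apply/rational_familyP; exists (enum_val i).1; rewrite /g /f; case: ifP; [right|left].
  have inA (x : {set 'I_n} * bool) : x \in A -> (g @` setT)%classic (f x).
    by move=> xA; exists (enum_rank_in xA x) => //; rewrite /g enum_rankK_in.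
  case=> [->|[I I0 [->|->]]].
  - by rewrite -c_elt0 -[c_elt R _]/(f (finset.set0, false)); apply: inA; rewrite !inE xpair_eqE andbF.
  - by rewrite -[c_elt R I]/(f (I, false)); apply: inA; rewrite !inE xpair_eqE (negPf I0).
  - by rewrite -[d_elt R I]/(f (I, true)); apply: inA; rewrite !inE xpair_eqE (negPf I0).
have -> : (1 + 2 * (2 ^ n - 1))%N = #|A|.
  rewrite cardsC1 card_prod card_bool -[#|{: {set 'I_n}}|]cardsT -powersetT card_powerset.
  rewrite cardsT card_ord.
  by have := expn_gt0 2 n; lia.
apply: card_eq_trans (inj_card_eq _) _; last by rewrite card_eq_sym; exact: card_II.
by move=> i j _ _ /f_inj E; apply: enum_val_inj; apply: E; apply: enum_valP.
Qed.

Lemma has_valency1P (u : 'M[R]_n.+1) : has_valency u 1 <->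
  exists v, forall w, adjacent u w <-> w = v.
Proof.
split=> [|[v uv]].
  rewrite /has_valency => /card_set_bijP[f [fI finj fsurj]].
  have [v uv fv] := fsurj 0%N isT.
  exists v => w; split=> [uw|->//].
  have fw : f w = 0%N by apply/eqP; rewrite -leqn0 -ltnS; exact: (fI _ uw).
  by apply: finj; rewrite ?inE //; rewrite fw.
rewrite /has_valency (_ : (fun _ => _) = [set v]%classic); first exact: card_set1.
by apply/seteqP; split=> w /uv.
Qed.

(** Toggling the last element of [1, ..., r - 1] is always an edge, and each
    [b > 1] in [I] gives another one by toggling [b - 1]; at the empty set there
    are two edges, one towards each family. *)
Lemma c_elt_valency1 (n_gt1 : (1 < n)%N) (I : {set 'I_n}) (i0 : 'I_n) : i0 = 0%N :> nat ->
  has_valency (c_elt R I) 1 <-> I = [set i0]%SET.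
Proof.
move=> i00; have kn : (n.-1 < n)%N by lia.
pose K := Ordinal kn; have Kn : @ord_max n = K.+1 :> nat by rewrite /= prednK.
rewrite has_valency1P; split=> [[v uniq]|->]; last first.
  exists (c_elt R (symdiff [set i0]%SET [set K]%SET)) => w; split; last first.
    by move=> ->; apply: (adjacent_c_elt Kn); apply: max_dom.
  case/adjacent_c_cases=> [[a [b [ba bI ->]]]|[/setP/(_ i0)]]; last by rewrite !inE eqxx.
  congr (c_elt R (symdiff _ [set _]%SET)); apply/val_inj => /=.
  have [bm|[i bi]] := ord_wid b; first by move: ba; rewrite bm /=; lia.
  by move: bI ba; rewrite bi wid_dom inE => /eqP->; rewrite /= i00.
have vE : v = c_elt R (symdiff I [set K]%SET).
  by apply/esym/uniq/(adjacent_c_elt Kn)/max_dom.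
have I0 : I != finset.set0.
  apply/eqP => I0; have : d_elt R (symdiff I [set K]%SET) = v.
    apply/uniq; have := adjacent_d_elt Kn (max_dom I).
    by rewrite {1}I0 d_elt0 -c_elt0 -I0.
  rewrite vE => /esym/c_elt_eq_d_elt[_]; rewrite I0 symdiff0 => /setP/(_ K).
  by rewrite !inE eqxx.
have sub i : i \in I -> i = i0.
  move=> iI; apply/eqP; rewrite -val_eqE /= i00; apply/negPn/negP => ine.
  have pi : (i.-1 < n)%N by have := ltn_ord i; lia.
  have wi : wid i = (Ordinal pi).+1 :> nat by rewrite /= prednK // lt0n.
  have : c_elt R (symdiff I [set Ordinal pi]%SET) = v.
    by apply/uniq/(adjacent_c_elt wi); rewrite wid_dom.
  rewrite vE => /c_elt_inj/symdiff1_inj/(congr1 val) /=.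
  by have := ltn_ord i; lia.
have [i iI] := set0Pn _ I0; apply/setP => j; rewrite inE.
apply/idP/eqP => [/sub//|->].
by rewrite -(sub _ iI).
Qed.

Lemma d_elt_valency1 (n_gt1 : (1 < n)%N) (I : {set 'I_n}) (i0 : 'I_n) : i0 = 0%N :> nat ->
  has_valency (d_elt R I) 1 <-> I = [set i0]%SET.
Proof.
move=> i00; rewrite -(c_elt_valency1 n_gt1 I i00) !has_valency1P.
split=> -[v uv]; exists (flip *m v *m flip) => w; split=> [|->].
- by move=> /adjacent_flip; rewrite -d_elt_flip => /uv<-; rewrite flip_flip.
- by rewrite c_elt_flip; apply/adjacent_flip/uv.
- by move=> /adjacent_flip; rewrite -c_elt_flip => /uv<-; rewrite flip_flip.
- by rewrite d_elt_flip; apply/adjacent_flip/uv.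
Qed.

End Roots.

Theorem theorem1p1 (R : realType) (n : nat) (hr : (5 <= n.+1)%N)
    (hodd : odd n.+1) :
  (forall u : 'M[R]_n.+1, rational_elt u <-> rational_family u) /\
  (card_eq (@rational_family R n) (`I_(1 + 2 * (2 ^ n - 1)))%classic /\
   (1 + 2 * (2 ^ n - 1) = 2 ^ n.+1 - 1)%N) /\
  (forall (I : {set 'I_n}) (a b : 'I_n), b = a.+1 :> nat ->
     (adjacent (c_elt R I) (c_elt R (symdiff I [set a]%SET)) <-> b \in I) /\
     (adjacent (d_elt R I) (d_elt R (symdiff I [set a]%SET)) <-> b \in I)) /\
  (forall (I : {set 'I_n}) (a : 'I_n), a.+1 = n ->
     adjacent (c_elt R I) (c_elt R (symdiff I [set a]%SET)) /\
     adjacent (d_elt R I) (d_elt R (symdiff I [set a]%SET))) /\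
  (forall u v : 'M[R]_n.+1, adjacent u v ->
     exists (I : {set 'I_n}) (a : 'I_n),
       (u = c_elt R I /\ v = c_elt R (symdiff I [set a]%SET)) \/
       (u = d_elt R I /\ v = d_elt R (symdiff I [set a]%SET))) /\
  (forall i0 : 'I_n, i0 = 0%N :> nat ->
     forall u : 'M[R]_n.+1, rational_elt u ->
       (has_valency u 1 <->
        u = c_elt R [set i0]%SET \/ u = d_elt R [set i0]%SET)).
Proof.
have n_gt0 : (0 < n)%N by lia.
have n_gt1 : (1 < n)%N by lia.
have n_even : ~~ odd n by move: hodd; rewrite /= => ->.
split; [|split; [|split; [|split; [|split]]]].
- by move=> u; rewrite (rational_eltP n_gt0 n_even) -rational_familyP.
- split; first exact: rational_family_card.
  by rewrite expnS; have := expn_gt0 2 n; lia.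
- move=> I a b ba; have bw : widen_ord (leqnSn n) b = a.+1 :> nat by [].
  by rewrite (adjacent_c_eltP R n_gt0 n_even I bw) (adjacent_d_eltP R n_gt0 n_even I bw) wid_dom.
- move=> I a an; have mw : @ord_max n = a.+1 :> nat by rewrite /= an.
  by split; [apply: adjacent_c_elt mw _ | apply: adjacent_d_elt mw _]; rewrite ?max_dom.
- move=> u v adj; have [ru _ _] := adj.
  have [I [uE|uE]] := (rational_eltP n_gt0 n_even u).1 ru; rewrite uE in adj *.
    case: (adjacent_c_cases n_gt0 n_even adj) => [[a [_ [_ _ ->]]]|[-> [K [_ ->]]]].
      by exists I, a; left.
    by exists finset.set0, K; right; rewrite c_elt0 d_elt0.
  case: (adjacent_d_cases n_gt0 n_even adj) => [[a [_ [_ _ ->]]]|[-> [K [_ ->]]]].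
    by exists I, a; right.
  by exists finset.set0, K; left; rewrite c_elt0 d_elt0.
- move=> i0 i00 u /(rational_eltP n_gt0 n_even)[I uE].
  have neq0 : [set i0]%SET <> finset.set0 by move=> /setP/(_ i0); rewrite !inE eqxx.
  case: uE => ->.
    rewrite (c_elt_valency1 R n_gt0 n_even n_gt1 I i00).
    split=> [->|]; first by left.
    by move=> [/(c_elt_inj n_gt0)|/(c_elt_eq_d_elt n_gt0)[_ /neq0]].
  rewrite (d_elt_valency1 R n_gt0 n_even n_gt1 I i00).
  split=> [->|]; first by right.
  by move=> [/esym/(c_elt_eq_d_elt n_gt0)[/neq0]|/(d_elt_inj n_gt0)].
Qed.
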